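(* Let $G$ be a graph on $n$ vertices, $n\in\mathbb N$. Let $X$ and $Y$ be two unital $C^*$-algebras, and let $U\in M_n(X)$ and $V\in M_n(Y)$ be two magic unitaries adapted to $G$. Assume that $U\neq I_n$, that $V\neq I_n$, and that $\mathrm{Supp}(U)\cap \mathrm{Supp}(V)=\varnothing$. Then there are two nontrivial unital $C^*$-algebras $X'$ and $Y'$ (each different from $0$ and from $\mathbb C$) such that their unital free product $X' *_1 Y'$ is a quotient of $C(\mathrm{Qu}(G))$. In particular, $C(\mathrm{Qu}(G))$ is nonabelian and infinite-dimensional, and $G$ has quantum symmetry.
   Context: Graphs are finite, simple and undirected, with at least one vertex. $\mathrm{Adj}(G)$ is the adjacency matrix of $G$, indexed by $V(G)$. Unital $C^*$-algebras are assumed nonzero. A magic unitary of size $n$ with coefficients in a unital $C^*$-algebra $X$ is a matrix $U=(u_{ij})\in M_n(X)$ whose entries are self-adjoint projections such that each row and each column sums to $1_X$. It is adapted to $G$ (with $V(G)=\{1,\dots,n\}$) if $U\,\mathrm{Adj}(G)=\mathrm{Adj}(G)\,U$. Its support is $\mathrm{Supp}(U)=\{x\in V(G)\mid u_{xx}\neq 1\}$. $C(\mathrm{Qu}(G))$ is the universal unital $C^*$-algebra generated by the entries $u_{xy}$ ($x,y\in V(G)$) of a magic unitary adapted to $G$. The graph $G$ has quantum symmetry if $C(\mathrm{Qu}(G))$ is not commutative. $X' *_1 Y'$ denotes the free product of unital $C^*$-algebras amalgamated over the unit; ''quotient'' means image under a surjective unital $*$-homomorphism. *)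

(* Defs.v *)
From HB Require Import structures.
From mathcomp Require Import all_boot all_order all_algebra.
From mathcomp Require Export complex.
From mathcomp Require Import boolp classical_sets filter reals topology normedtype sequences.
Set Implicit Arguments.
Unset Strict Implicit.
Unset Printing Implicit Defensive.
Import Order.TTheory GRing.Theory Num.Theory numFieldNormedType.Exports.
Import ComplexField.Normc.
Local Open Scope ring_scope.
Local Open Scope complex_scope.

(* The norm is a field of the mixin because a structure inheriting from both
   algType and normedModType cannot be declared downstream of numDomainType,
   which already inherits from their ring and norm parts without a join.
   As algType extends nzRingType, all these algebras are unital and nonzero. *)
#[key="A"]
HB.mixin Record isUnitalCStarAlgebra (R : realType) (A : Type)
    of GRing.Algebra R[i] A := {
  star : A -> A;
  cnorm : A -> R;
  starK : involutive star;
  starD : {morph star : x y / x + y};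
  starZ : forall (c : R[i]) (x : A), star (c *: x) = c^* *: star x;
  starM : forall x y : A, star (x * y) = star y * star x;
  cnorm0_eq0 : forall x : A, cnorm x = 0 -> x = 0;
  cnormD_le : forall x y : A, cnorm (x + y) <= cnorm x + cnorm y;
  cnormZ : forall (c : R[i]) (x : A), cnorm (c *: x) = normc c * cnorm x;
  cnormM_le : forall x y : A, cnorm (x * y) <= cnorm x * cnorm y;
  cnorm_starM : forall x : A, cnorm (star x * x) = cnorm x ^+ 2;
  cnorm_complete : forall u : nat -> A,
    (forall eps : R, 0 < eps -> exists N : nat, forall m k : nat,
       (N <= m)%N -> (N <= k)%N -> cnorm (u m - u k) < eps) ->
    exists l : A, forall eps : R, 0 < eps -> exists N : nat, forall m : nat,
       (N <= m)%N -> cnorm (u m - l) < eps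
}.

#[short(type="cstarAlgType")]
HB.structure Definition UnitalCStarAlgebra (R : realType) :=
  {A of isUnitalCStarAlgebra R A & GRing.Algebra R[i] A}.

(* The C*-algebra of complex numbers, on the library's alias [R[i]^o], which
   carries the algebra structure of a ring over itself. *)
Section ComplexNumbers.
Variable R : realType.

Lemma real_seq_complete (v : nat -> R) :
  (forall eps : R, 0 < eps -> exists N : nat, forall m k : nat,
     (N <= m)%N -> (N <= k)%N -> `|v m - v k| < eps) ->
  exists l : R, forall eps : R, 0 < eps -> exists N : nat, forall m : nat,
     (N <= m)%N -> `|v m - l| < eps.
Proof.
move=> vC; have /cvg_ex [l vl] : cvgn v.
  apply: cauchy_cvg; apply: cauchy_exP => eps eps0.
  have [N NP] := vC _ eps0.
  by exists (v N), N => // m Nm; apply: NP => //; apply: leqnn.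
exists l => eps eps0; have /cvgrPdist_lt/(_ _ eps0)[N _ NP] := vl.
by exists N => m Nm; rewrite distrC; apply: NP.
Qed.

Lemma normRe_le (z : R[i]) : `|complex.Re z| <= normc z.
Proof. by case: z => a b /=; rewrite -sqrtr_sqr ler_wsqrtr// lerDl sqr_ge0. Qed.

Lemma normIm_le (z : R[i]) : `|complex.Im z| <= normc z.
Proof. by case: z => a b /=; rewrite -sqrtr_sqr ler_wsqrtr// lerDr sqr_ge0. Qed.

Lemma normc_le_ReIm (z : R[i]) :
  normc z <= `|complex.Re z| + `|complex.Im z|.
Proof.
case: z => a b /=.
rewrite -[leRHS]ger0_norm ?addr_ge0// -sqrtr_sqr ler_wsqrtr//.
rewrite sqrrD !real_normK ?num_real//.
by rewrite lerD2r lerDl mulrn_wge0// mulr_ge0.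
Qed.

Lemma complex_complete (u : nat -> R[i]) :
  (forall eps : R, 0 < eps -> exists N : nat, forall m k : nat,
     (N <= m)%N -> (N <= k)%N -> normc (u m - u k) < eps) ->
  exists l : R[i], forall eps : R, 0 < eps -> exists N : nat, forall m : nat,
     (N <= m)%N -> normc (u m - l) < eps.
Proof.
move=> uC.
have [|a aP] := @real_seq_complete (fun m => complex.Re (u m)).
  move=> e /uC[N NP]; exists N => m k Nm Nk.
  apply: le_lt_trans (NP m k Nm Nk); rewrite -raddfB; exact: normRe_le.
have [|b bP] := @real_seq_complete (fun m => complex.Im (u m)).
  move=> e /uC[N NP]; exists N => m k Nm Nk.
  apply: le_lt_trans (NP m k Nm Nk); rewrite -raddfB; exact: normIm_le.
exists (a +i* b) => e e0; have e20 : 0 < e / 2 by rewrite divr_gt0.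
have [[N1 P1] [N2 P2]] := (aP _ e20, bP _ e20).
exists (maxn N1 N2) => m; rewrite geq_max => /andP[/P1 h1 /P2 h2].
apply: le_lt_trans (normc_le_ReIm _) _; rewrite [e]splitr.
by case: (u m) h1 h2 => c d /= h1 h2; apply: ltrD.
Qed.

Lemma normc_conjM (x : R[i]) : normc (x^* * x) = normc x ^+ 2.
Proof. by rewrite normcM expr2; congr (_ * _); case: x => a b /=; rewrite sqrrN. Qed.

Lemma conjc_M (x y : R[i]) : (x * y)^* = y^* * x^*.
Proof. by rewrite rmorphM mulrC. Qed.

Lemma normc_le_M (x y : R[i]) : normc (x * y) <= normc x * normc y.
Proof. by rewrite normcM. Qed.

HB.instance Definition _ := isUnitalCStarAlgebra.Build R (R[i]^o)
  (@conjcK R) (fun x y => rmorphD conjc x y) (fun c x => rmorphM conjc c x)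
  conjc_M (@eq0_normc R) (@le_normcD R) (@normcM R) normc_le_M normc_conjM
  complex_complete.

End ComplexNumbers.

Section CStarNotions.
Variable R : realType.
Implicit Types A B F Q X Y Z : cstarAlgType R.

Definition star_hom A B (f : {lrmorphism A -> B}) :=
  forall a : A, f (star a) = star (f a).

Definition is_quotient A B :=
  exists f : {lrmorphism A -> B}, star_hom f /\ (forall b, exists a, f a = b).

Definition isomorphic A B :=
  exists f : {lrmorphism A -> B}, star_hom f /\ bijective f.

(* Neither 0 nor the complex numbers. *)
Definition nontrivial A :=
  (1 : A) <> 0 /\ ~ isomorphic A R[i]^o.

Definition commutative_alg A := forall a b : A, a * b = b * a.

Definition infinite_dimensional A :=
  forall (k : nat) (b : 'I_k -> A),
    exists a : A, forall c : 'I_k -> R[i], a <> \sum_(i < k) c i *: b i.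

(* The only norm-closed unital *-subalgebra of A containing S is A itself. *)
Definition generated_by A (S : A -> Prop) :=
  forall P : A -> Prop,
    (forall a, S a -> P a) ->
    P 1 ->
    (forall a b, P a -> P b -> P (a + b)) ->
    (forall (c : R[i]) a, P a -> P (c *: a)) ->
    (forall a b, P a -> P b -> P (a * b)) ->
    (forall a, P a -> P (star a)) ->
    (forall a, (forall eps : R, 0 < eps ->
       exists2 b, P b & cnorm (a - b) < eps) -> P a) ->
  forall a, P a.

(* Unital free product, as the coproduct of unital C*-algebras, with
   canonical maps iX and iY. *)
Definition is_free_product X Y F
    (iX : {lrmorphism X -> F}) (iY : {lrmorphism Y -> F}) :=
  [/\ star_hom iX, star_hom iY &
   forall Z (f : {lrmorphism X -> Z}) (g : {lrmorphism Y -> Z}),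
     star_hom f -> star_hom g ->
     exists h : {lrmorphism F -> Z},
       [/\ star_hom h, (forall x, h (iX x) = f x), (forall y, h (iY y) = g y) &
        forall h' : {lrmorphism F -> Z}, star_hom h' ->
          (forall x, h' (iX x) = f x) -> (forall y, h' (iY y) = g y) ->
          forall a, h' a = h a]].

Definition projection A (p : A) := star p = p /\ p * p = p.

Definition magic_unitary A n (U : 'M[A]_n) :=
  [/\ forall i j, projection (U i j),
      forall i, \sum_j U i j = 1 &
      forall j, \sum_i U i j = 1].

End CStarNotions.

Record simple_graph (n : nat) := SimpleGraph {
  edge :> rel 'I_n;
  edge_sym : symmetric edge;
  edge_irrefl : irreflexive edge
}.

Definition adjacency (A : pzRingType) n (G : simple_graph n) : 'M[A]_n :=
  \matrix_(i, j) (G i j)%:R.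

Section QuantumAutomorphisms.
Variables (R : realType) (n : nat).
Implicit Types (A Q Z : cstarAlgType R) (G : simple_graph n).

Definition adapted G A (U : 'M[A]_n) :=
  U *m adjacency A G = adjacency A G *m U.

Definition Supp A (U : 'M[A]_n) : {set 'I_n} := [set x | U x x != 1].

(* Q is C(Qu(G)), with q the matrix of its canonical generators.  Uniqueness of
   f follows from generation, *-homomorphisms being continuous. *)
Definition is_CQu G Q (q : 'M[Q]_n) :=
  [/\ magic_unitary q,
      adapted G q,
      generated_by (fun a => exists x y, a = q x y) &
      forall Z (w : 'M[Z]_n), magic_unitary w -> adapted G w ->
        exists2 f : {lrmorphism Q -> Z}, star_hom f &
          forall x y, f (q x y) = w x y].

End QuantumAutomorphisms.

(* Existential, so that it also asserts that C(Qu(G)) exists. *)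
Definition has_quantum_symmetry (R : realType) n (G : simple_graph n) :=
  exists (Q : cstarAlgType R) (q : 'M[Q]_n),
    is_CQu G q /\ ~ commutative_alg Q.

(* Main.v *)
(* Let [S] and [T] be the supports of [U] and [V], and let X', Y', F be the
   universal C*-algebras generated by a quantum permutation of [G] supported on
   [S], one supported on [T], and one of each; then F = X' *_1 Y'.  In F the
   matrix U V has the rows of [U] on [S] and those of [V] elsewhere, so it is
   again a magic unitary adapted to [G], and its entries generate F; since the
   image of a *-homomorphism is closed, C(Qu(G)) -> F is onto.

   If C(Qu(G)) were commutative or finite-dimensional, the entries of its
   generating matrix would lie in a finite-dimensional *-subalgebra.  The images
   of the latter under U and V are finite-dimensional C*-algebras, on which the
   trace of left multiplication is a faithful positive functional; so [U] and [V]
   may be taken with coefficients in M_a(C) and M_b(C).  In M_a (x) M_b (x) M_2 cut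
   them down to [e] and [f], where [e] and [f] are projections of M_2 such that
   e f e = t e.  For a suitable element [g] of C(Qu(G)), independent of [t],
   the image of [g] is nonzero with g^2 = t g.  As [t] ranges over the
   interval from 0 to 1, no nonzero polynomial annihilates [g]. *)
Require Import Defs.
From HB Require Import structures.
From mathcomp Require Import boolp classical_sets reals topology normedtype sequences.
From mathcomp Require Import all_boot all_order all_algebra.
From mathcomp Require Import mxred spectral mxtens.
From mathcomp Require Import ring lra.
Set Implicit Arguments.
Unset Strict Implicit.
Unset Printing Implicit Defensive.
Import Order.TTheory GRing.Theory Num.Theory numFieldNormedType.Exports.
Import ComplexField.Normc.
Local Open Scope ring_scope.
Local Open Scope complex_scope.

(** * Norms and limits in a C*-algebra *)

(** Surjectivity onto F needs *-homomorphisms to be contractive with closed range, and this is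
    obtained without spectra or positivity. A self-adjoint [s] of norm below 1 can be completed to
    [s * s + c * c = 1] with [c] self-adjoint and commuting with [s]; conversely such a relation
    bounds the norm of [s] by 1, as [s + 'i *: c] is unitary. *-homomorphisms preserve the relation,
    hence the bound. Closedness follows by successive approximation, where approximate preimages are
    cut down in norm by a rational function. Noncommutativity is not deduced from the free product:
    for arbitrary coefficient algebras, placing [U] and [V] in commuting tensor factors would call
    for faithful representations on Hilbert spaces. Under the contrary assumption only
    finite-dimensional algebras have to be represented, and linear algebra suffices. Since any two
    quantum permutations with disjoint supports can be glued, the angle between the projections [e]
    and [f] remains a free parameter. *)

Definition limit_of (R : realType) (A : cstarAlgType R) (u : nat -> A) (l : A) := forall eps : R, 0 < eps ->
  exists N, forall m, (N <= m)%N -> cnorm (u m - l) < eps.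

Section NormBasics.
Variables (R : realType) (A : cstarAlgType R).
Implicit Types (x y l : A) (u : nat -> A).

Lemma star0 : star (0 : A) = 0.
Proof. by rewrite -(scale0r (0 : A)) starZ rmorph0 !scale0r. Qed.

Lemma star1 : star (1 : A) = 1.
Proof. by rewrite -[LHS]mul1r -{1}[1]starK -starM mul1r starK. Qed.

Lemma starN x : star (- x) = - star x.
Proof. by rewrite -scaleN1r starZ rmorphN rmorph1 scaleN1r. Qed.

Lemma starB x y : star (x - y) = star x - star y.
Proof. by rewrite starD starN. Qed.

Lemma star_sum (I : Type) (r : seq I) (P : pred I) (F : I -> A) :
  star (\sum_(i <- r | P i) F i) = \sum_(i <- r | P i) star (F i).
Proof. exact: (big_morph _ starD star0). Qed.

Lemma starX x k : star (x ^+ k) = star x ^+ k.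
Proof. by elim: k => [|k IH]; rewrite ?expr0 ?star1 // exprS starM IH -exprSr. Qed.

Lemma normc_ge0 (c : R[i]) : 0 <= normc c.
Proof. by case: c => a b; apply: sqrtr_ge0. Qed.

Lemma normc_real (r : R) : normc (r%:C) = `|r|.
Proof. by rewrite /= expr0n addr0 sqrtr_sqr. Qed.

Lemma normc_i : normc ('i : R[i]) = 1.
Proof. by rewrite /= expr0n expr1n add0r sqrtr1. Qed.

Lemma cnorm0 : cnorm (0 : A) = 0.
Proof. by rewrite -(scale0r (0 : A)) cnormZ normc0 mul0r. Qed.

Lemma cnormN x : cnorm (- x) = cnorm x.
Proof. by rewrite -scaleN1r cnormZ normcN normc1 mul1r. Qed.

Lemma cnormBC x y : cnorm (x - y) = cnorm (y - x).
Proof. by rewrite -cnormN opprB. Qed.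

Lemma cnormZr (r : R) x : cnorm (r%:C *: x) = `|r| * cnorm x.
Proof. by rewrite cnormZ normc_real. Qed.

Lemma cnorm_ge0 x : 0 <= cnorm x.
Proof. by have := cnormD_le x (- x); rewrite subrr cnorm0 cnormN; lra. Qed.

Lemma cnormB_trans z x y : cnorm (x - y) <= cnorm (x - z) + cnorm (z - y).
Proof. by rewrite -[X in cnorm X <= _](subrKA z) cnormD_le. Qed.

Lemma cnorm_eq0 x : (cnorm x == 0) = (x == 0).
Proof. by apply/eqP/eqP => [/cnorm0_eq0 //|->]; rewrite cnorm0. Qed.

Lemma cnorm_gt0 x : (0 < cnorm x) = (x != 0).
Proof. by rewrite lt_def cnorm_ge0 andbT cnorm_eq0. Qed.

Lemma cnorm1 : cnorm (1 : A) = 1.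
Proof.
have := cnorm_starM (1 : A); rewrite star1 mulr1 expr2 => /esym h.
have n0 : cnorm (1 : A) != 0 by rewrite cnorm_eq0 oner_eq0.
by apply: (mulfI n0); rewrite h mulr1.
Qed.

Lemma cnorm_star x : cnorm (star x) = cnorm x.
Proof.
have le y : cnorm y <= cnorm (star y).
  have [->|y0] := eqVneq y 0; first by rewrite star0.
  rewrite -(ler_pM2r (x := cnorm y)) ?cnorm_gt0 //.
  by rewrite -expr2 -cnorm_starM cnormM_le.
by apply/eqP; rewrite eq_le le andbT -{2}(starK x) le.
Qed.

Lemma cnorm_selfadjoint_sqr x : star x = x -> cnorm (x * x) = cnorm x ^+ 2.
Proof. by move=> sx; rewrite -{1}sx cnorm_starM. Qed.

Lemma cnorm_unitary x : star x * x = 1 -> cnorm x = 1.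
Proof.
move=> x1; have := cnorm_starM x; rewrite x1 cnorm1 => /esym/eqP.
by rewrite sqrf_eq1 => /orP[/eqP//|/eqP xN]; have := cnorm_ge0 x; rewrite xN; lra.
Qed.

Lemma starM_eq0 x : star x * x = 0 -> x = 0.
Proof.
move=> x0; apply: cnorm0_eq0; apply/eqP; rewrite -sqrf_eq0 -cnorm_starM x0.
by rewrite cnorm0.
Qed.

(** By the C*-identity a self-adjoint element of square zero vanishes, so an exponent [2 ^ j] can be
    halved down to 1; any [k] is below [2 ^ k]. *)
Lemma selfadjoint_nilpotent x k : star x = x -> x ^+ k = 0 -> x = 0.
Proof.
move=> sx; have E j : x ^+ (2 ^ j) = 0 -> x = 0.
  elim: j => [|j IH]; first by rewrite expr1.
  by rewrite expnS mulnC exprM expr2 -{1}sx -starX => /starM_eq0.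
move=> xk; apply: (E k); apply/eqP.
by rewrite -(subnK (ltnW (ltn_expl k (ltnSn 1)))) exprD xk mulr0.
Qed.

Lemma cnorm_sum (I : Type) (r : seq I) (P : pred I) (F : I -> A) :
  cnorm (\sum_(i <- r | P i) F i) <= \sum_(i <- r | P i) cnorm (F i).
Proof.
apply: (big_ind2 (fun x (y : R) => cnorm x <= y)); rewrite ?cnorm0 //.
by move=> x1 y1 x2 y2 h1 h2; apply: le_trans (cnormD_le _ _) (lerD h1 h2).
Qed.

Lemma small_norm_eq0 x : (forall eps : R, 0 < eps -> cnorm x <= eps) -> x = 0.
Proof.
move=> h; apply/eqP/negPn/negP => x0; rewrite -cnorm_gt0 in x0.
by have := h (cnorm x / 2) ltac:(lra); lra.
Qed.

Lemma limit_unique u l l' : limit_of u l -> limit_of u l' -> l = l'.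
Proof.
move=> h h'; apply/eqP; rewrite -subr_eq0; apply/eqP/small_norm_eq0 => e e0.
have [N HN] := h (e / 2) ltac:(lra); have [N' HN'] := h' (e / 2) ltac:(lra).
have := HN (maxn N N') (leq_maxl _ _); have := HN' (maxn N N') (leq_maxr _ _).
have := cnormB_trans (u (maxn N N')) l l'; rewrite (cnormBC l (u _)); lra.
Qed.

(** The common source of the continuity statements below. The sequence [v] may live in another
    algebra, as needed for *-homomorphisms. *)
Lemma limit_dominated (B : cstarAlgType R) u l (v : nat -> B) k (C : R) :
  limit_of u l -> (forall m, cnorm (v m - k) <= C * cnorm (u m - l)) ->
  limit_of v k.
Proof.
move=> h hv e e0; have C1 : 0 < `|C| + 1 by have := normr_ge0 C; lra.
have [N HN] := h (e / (`|C| + 1)) ltac:(by rewrite divr_gt0).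
exists N => m /HN; rewrite ltr_pdivlMr // => hm; apply: le_lt_trans (hv m) _.
apply: le_lt_trans hm; rewrite mulrC ler_wpM2l ?cnorm_ge0 //.
by have := ler_norm C; lra.
Qed.

Lemma limit_shift u l : limit_of u l -> limit_of (fun m => u m.+1) l.
Proof. by move=> h e /h[N HN]; exists N => m Nm; apply: HN; apply: leqW. Qed.

Lemma limit_add u l v k :
  limit_of u l -> limit_of v k -> limit_of (fun m => u m + v m) (l + k).
Proof.
move=> h h' e e0.
have [N HN] := h (e / 2) ltac:(lra); have [N' HN'] := h' (e / 2) ltac:(lra).
exists (maxn N N') => m; rewrite geq_max => /andP[/HN h1 /HN' h2].
by rewrite opprD addrACA; apply: le_lt_trans (cnormD_le _ _) _; lra.
Qed.

Lemma limit_mull (z : A) u l : limit_of u l -> limit_of (fun m => z * u m) (z * l).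
Proof.
by move=> h; apply: (limit_dominated (C := cnorm z) h) => m; rewrite -mulrBr cnormM_le.
Qed.

Lemma limit_mulr (z : A) u l : limit_of u l -> limit_of (fun m => u m * z) (l * z).
Proof.
by move=> h; apply: (limit_dominated (C := cnorm z) h) => m; rewrite -mulrBl mulrC cnormM_le.
Qed.

Lemma limit_cst (z : A) : limit_of (fun=> z) z.
Proof. by move=> e e0; exists 0 => m _; rewrite subrr cnorm0. Qed.

Lemma limit_scale (c : R[i]) u l :
  limit_of u l -> limit_of (fun m => c *: u m) (c *: l).
Proof.
by move=> h; apply: (limit_dominated (C := normc c) h) => m; rewrite -scalerBr cnormZ.
Qed.

Lemma limit_star u l : limit_of u l -> limit_of (fun m => star (u m)) (star l).
Proof.
by move=> h; apply: (limit_dominated (C := 1) h) => m; rewrite -starB cnorm_star mul1r.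
Qed.

Lemma limit_norm_le u l (C : R) :
  limit_of u l -> (forall m, cnorm (u m) <= C) -> cnorm l <= C.
Proof.
move=> h uC; rewrite leNgt; apply/negP => Cl.
have [N /(_ N (leqnn N)) HN] := h (cnorm l - C) ltac:(lra).
have := cnormD_le (u N) (l - u N); rewrite addrC subrK cnormBC.
have := uC N; lra.
Qed.

Lemma geometric_bound (a r e : R) : 0 <= r < 1 -> 0 < e ->
  exists N, forall m, (N <= m)%N -> a * r ^+ m < e.
Proof.
move=> /andP[r0 r1] e0.
have := @cvg_geometric R a r; rewrite ger0_norm // => /(_ r1).
move=> /cvgrPdist_lt/(_ _ e0)[N _ HN]; exists N => m /HN.
by rewrite /= sub0r normrN /geometric => /=; apply: le_lt_trans (ler_norm _).
Qed.

Lemma geometric_limit (u : nat -> A) (a r : R) : 0 <= r < 1 ->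
  (forall m, cnorm (u m.+1 - u m) <= a * r ^+ m) -> exists l, limit_of u l.
Proof.
move=> r01 hu; have /andP[r0 r1] := r01.
have r1' : 0 < 1 - r by lra.
have a0 : 0 <= a by apply: le_trans (cnorm_ge0 (u 1%N - u 0%N)) _; rewrite -[a]mulr1 -(expr0 r) hu.
have tail m k : cnorm (u (m + k)%N - u m) <= a / (1 - r) * (r ^+ m - r ^+ (m + k)).
  elim: k => [|k IH]; first by rewrite addn0 !subrr cnorm0 mulr0.
  apply: le_trans (cnormB_trans (u (m + k)%N) _ _) _.
  have -> : a / (1 - r) * (r ^+ m - r ^+ (m + k.+1)) =
     a * r ^+ (m + k) + a / (1 - r) * (r ^+ m - r ^+ (m + k)).
    by rewrite addnS exprS; field; lra.
  by rewrite lerD // addnS hu.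
have tail' m k : (m <= k)%N -> cnorm (u k - u m) <= a / (1 - r) * r ^+ m.
  move=> mk; rewrite -(subnKC mk); apply: le_trans (tail _ _) _.
  by rewrite ler_wpM2l ?divr_ge0 ?(ltW r1') // lerBlDr lerDl exprn_ge0.
apply: cnorm_complete => e e0.
have [N HN] := geometric_bound (a / (1 - r)) r01 (ltac:(lra) : 0 < e / 2).
exists N => m k Nm Nk; apply: le_lt_trans (cnormB_trans (u N) _ _) _.
by rewrite (cnormBC (u N)); have := tail' _ _ Nm; have := tail' _ _ Nk; have := HN N (leqnn N); lra.
Qed.

End NormBasics.

(** * Self-adjoint elements *)

Section SelfAdjoint.
Variables (R : realType) (A : cstarAlgType R).
Implicit Types x y s c d : A.

Lemma starZr (r : R) x : star (r%:C *: x) = r%:C *: star x.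
Proof. by rewrite starZ; congr (_ *: _); apply/eqP; rewrite eq_complex /= oppr0 !eqxx. Qed.

Lemma starZi x : star ('i *: x) = - ('i *: star x).
Proof. by rewrite starZ -scaleNr; congr (_ *: _); apply/eqP; rewrite eq_complex /= oppr0 !eqxx. Qed.

Lemma scale_half x : (2^-1)%:C *: (x + x) = x.
Proof.
by rewrite -mulr2n -[x *+ 2]scaler_nat scalerA
  -(rmorph_nat (real_complex R)) -rmorphM mulVf ?pnatr_eq0 // rmorph1 scale1r.
Qed.

Lemma mulii : 'i * 'i = -1 :> R[i].
Proof. by rewrite -expr2 sqr_i. Qed.

(* [a + 'i *: c] is unitary and [a] is its real part. *)
Lemma circle_norm a c : star a = a -> star c = c -> a * c = c * a ->
  a * a + c * c = 1 -> cnorm a <= 1.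
Proof.
move=> sa sc ac ac1; pose w := a + 'i *: c.
have sw : star w = a - 'i *: c by rewrite starD sa starZi sc.
have w1 : cnorm w = 1.
  apply: cnorm_unitary; rewrite sw /w mulrDr !mulrDl !mulNr -!scalerAl -!scalerAr ac.
  by rewrite scalerA mulii scaleN1r opprK addrA subrK.
have -> : a = (2^-1)%:C *: (w + star w).
  by rewrite sw /w addrACA subrr addr0 scale_half.
rewrite cnormZr ger0_norm ?invr_ge0 //.
have := cnormD_le w (star w); rewrite cnorm_star w1; lra.
Qed.

(* [c = 1 - y], where [y] is the fixed point of [y |-> (s^2 + y^2) / 2],
   a contraction of the ball of radius [cnorm s]. *)
Lemma circle_complete s : star s = s -> cnorm s < 1 ->
  exists c, [/\ star c = c, s * c = c * s & s * s + c * c = 1].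
Proof.
move=> ss s1; set rho := cnorm s; have rho0 : 0 <= rho := cnorm_ge0 s.
pose y := fix y k : A := if k is k'.+1 then (2^-1)%:C *: (s * s + y k' * y k') else 0.
have yS k : y k.+1 = (2^-1)%:C *: (s * s + y k * y k) by [].
have ys k : star (y k) = y k.
  by elim: k => [|k IH]; rewrite ?star0 // yS starZr starD !starM ss IH.
have yc k : s * y k = y k * s.
  elim: k => [|k IH]; first by rewrite mulr0 mul0r.
  by rewrite yS -scalerAl -scalerAr mulrDl mulrDr !mulrA IH -!mulrA IH.
have yn k : cnorm (y k) <= rho.
  elim: k => [|k IH]; first by rewrite cnorm0.
  rewrite yS cnormZr ger0_norm ?invr_ge0 //.
  have := cnormD_le (s * s) (y k * y k).
  have := cnormM_le s s; have := cnormM_le (y k) (y k); rewrite -/rho => h1 h2 h3.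
  have := ler_pM (cnorm_ge0 _) (cnorm_ge0 _) IH IH.
  have : rho * rho <= rho by rewrite ler_piMr // ltW.
  by lra.
(* From [x * x - z * z = x * (x - z) + (x - z) * z], which needs no commutation. *)
have sq x z : cnorm (x * x - z * z) <= (cnorm x + cnorm z) * cnorm (x - z).
  rewrite -[X in cnorm X](subrKA (x * z)) -mulrBr -mulrBl.
  apply: le_trans (cnormD_le _ _) _; rewrite [leRHS]mulrDl.
  by rewrite lerD ?cnormM_le // (mulrC (cnorm z)) cnormM_le.
have yd k : cnorm (y k.+1 - y k) <= 1 * rho ^+ k.
  elim: k => [|k IH].
    by rewrite subr0 expr0 mulr1; apply: le_trans (yn 1%N) (ltW s1).
  rewrite yS {3}yS -scalerBr cnormZr ger0_norm ?invr_ge0 // opprD addrACA subrr add0r.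
  rewrite exprS mulrCA.
  have := sq (y k.+1) (y k); have := ler_wpM2l rho0 IH.
  have := ler_wpM2r (cnorm_ge0 (y k.+1 - y k)) (lerD (yn k.+1) (yn k)).
  by lra.
have rho01 : 0 <= rho < 1 by rewrite rho0.
have [l yl] := geometric_limit rho01 yd.
have ls : star l = l.
  apply: (limit_unique _ yl); have := limit_star yl.
  by congr limit_of; apply/funext => k; rewrite ys.
have lc : s * l = l * s.
  apply: (limit_unique (limit_mull s yl)); have := limit_mulr s yl.
  by congr limit_of; apply/funext => k; rewrite yc.
have ln : cnorm l <= rho by exact: limit_norm_le yl yn.
have ll : l = (2^-1)%:C *: (s * s + l * l).
  apply: (limit_unique (limit_shift yl)); apply: limit_scale; apply: limit_add (limit_cst _) _.
  apply: (limit_dominated (C := rho + rho) yl) => k.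
  by apply: le_trans (sq _ _) _; rewrite ler_wpM2r ?cnorm_ge0 // lerD.
have l2 : l + l = s * s + l * l by rewrite {1 2}ll -scalerDr scale_half.
exists (1 - l); split; first by rewrite starB star1 ls.
  by rewrite mulrBl mulrBr mulr1 mul1r lc.
by rewrite mulrBl mul1r mulrBr mulr1 opprB addrCA (addrA (s * s)) -l2 addrK subrK.
Qed.

Lemma neumann z : cnorm z < 1 -> exists e : A, e * (1 - z) = 1 /\ (1 - z) * e = 1.
Proof.
move=> z1; pose y k : A := \sum_(i < k) z ^+ i.
have yS k : y k.+1 = 1 + z * y k.
  by rewrite /y big_ord_recl expr0 mulr_sumr; congr (_ + _); apply: eq_bigr => i _; rewrite exprS.
have yS' k : y k.+1 = 1 + y k * z.
  by rewrite /y big_ord_recl expr0 mulr_suml; congr (_ + _); apply: eq_bigr => i _; rewrite exprSr.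
have z01 : 0 <= cnorm z < 1 by rewrite cnorm_ge0.
have yd k : cnorm (y k.+1 - y k) <= 1 * cnorm z ^+ k.
  rewrite /y big_ord_recr /= addrAC subrr add0r mul1r.
  elim: k => [|k IH]; first by rewrite !expr0 cnorm1.
  by rewrite !exprS; apply: le_trans (cnormM_le _ _) _; rewrite ler_wpM2l ?cnorm_ge0.
have [l yl] := geometric_limit z01 yd.
have l1 : l = 1 + z * l.
  by apply: (limit_unique (limit_shift yl)); rewrite (funext yS); apply: limit_add (limit_cst _) (limit_mull z yl).
have l2 : l = 1 + l * z.
  by apply: (limit_unique (limit_shift yl)); rewrite (funext yS'); apply: limit_add (limit_cst _) (limit_mulr z yl).
exists l; rewrite mulrBl mulrBr mul1r mulr1.
by split; [rewrite {1}l2|rewrite {1}l1]; rewrite addrK.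
Qed.

(* The last two bounds say that the real and imaginary parts
   of the Cayley transform of [s] are contractions. *)
Lemma resolvent_bound s : star s = s ->
  exists d, [/\ star d = d, s * d = d * s, d * (1 + s * s) = 1,
    cnorm d <= 1 & cnorm (s * d) <= 2^-1].
Proof.
(* Dividing by [M] brings [s] into the open unit ball, where it has a companion [c] on the
   circle. *)
move=> ss; pose M := cnorm s + 1; have M0 : 0 < M by have := cnorm_ge0 s; rewrite /M; lra.
pose t := M^-1%:C *: s.
have st : star t = t by rewrite starZr ss.
have t1 : cnorm t < 1.
  by rewrite cnormZr ger0_norm ?invr_ge0 ?(ltW M0) // mulrC ltr_pdivrMr // mul1r /M ltrDl.
have [c [sc tc tc1]] := circle_complete st t1.
have c1 : cnorm c <= 1 by apply: (circle_norm (c := t)); rewrite // addrC.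
pose N := 1 + M ^+ 2; have N0 : 0 < N by rewrite /N; have := sqr_ge0 M; lra.
(* Chosen so that [1 + s * s = N (1 - z)]: with [s = M t] and [t * t = 1 - c * c], the left side is
   [N - M ^+ 2 c * c]. As [c] is a contraction, [z] has norm below 1 and the Neumann series inverts
   [1 - z]. *)
pose z := (M ^+ 2 / N)%:C *: (c * c).
have z1 : cnorm z < 1.
  rewrite cnormZr cnorm_selfadjoint_sqr // ger0_norm ?divr_ge0 ?sqr_ge0 ?(ltW N0) //.
  have h : cnorm c ^+ 2 <= 1 by rewrite expr_le1 ?cnorm_ge0.
  apply: le_lt_trans (ler_wpM2l _ h) _; first by rewrite ?divr_ge0 ?sqr_ge0 ?(ltW N0).
  by rewrite mulr1 ltr_pdivrMr // mul1r /N ltrDr.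
have [e [e1 e2]] := neumann z1.
have zE : 1 - z = N^-1%:C *: (1 + s * s).
  have cc : c * c = 1 - t * t by rewrite -tc1 addrAC subrr add0r.
  have tt : t * t = (M^-1 * M^-1)%:C *: (s * s).
    by rewrite -scalerAl -scalerAr scalerA -rmorphM.
  have E1 : (M ^+ 2 / N)%:C * (M^-1 * M^-1)%:C = N^-1%:C :> R[i].
    by rewrite -rmorphM; congr (_%:C); field; rewrite !lt0r_neq0.
  have E2 : 1 - (M ^+ 2 / N)%:C = N^-1%:C :> R[i].
    by rewrite -(rmorph1 (real_complex R)) -rmorphB; congr (_%:C); rewrite /N; field; rewrite lt0r_neq0.
  rewrite /z cc tt scalerBr scalerA E1 opprB addrCA scalerDr addrC; congr (_ + _).
  by rewrite -[X in X - _]scale1r -scalerBl E2.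
pose k := 1 + s * s; pose d := N^-1%:C *: e.
have dk : d * k = 1 by rewrite -e1 zE -scalerAl -scalerAr.
have kd : k * d = 1 by rewrite -e2 zE -scalerAl -scalerAr.
have sk : star k = k by rewrite starD star1 starM ss.
have sd : star d = d.
  have h : star d * k = 1 by rewrite -[LHS]starK starM starK sk kd star1.
  by rewrite -[star d]mulr1 -kd mulrA h mul1r.
have ks : k * s = s * k by rewrite mulrDl mulrDr mul1r mulr1 mulrA.
have sdc : s * d = d * s.
  by rewrite -[LHS]mul1r -dk -[d * k * _]mulrA (mulrA k) ks -(mulrA s) kd mulr1.
(* The imaginary and real parts, up to sign, of the Cayley transform. They lie on the circle since
   [4 s^2 + (1 - s^2)^2 = (1 + s^2)^2]; moreover [d = (1 + y) / 2] and [s * d = x / 2]. *)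
pose x := (s * d) *+ 2; pose y := (1 - s * s) * d.
have comm_s_y : s * (1 - s * s) = (1 - s * s) * s by rewrite mulrBl mulrBr mul1r mulr1 mulrA.
have comm_d_y : d * (1 - s * s) = (1 - s * s) * d.
  by rewrite mulrBl mulrBr mul1r mulr1 mulrA -sdc -mulrA -sdc mulrA.
have sx : star x = x by rewrite /x mulr2n starD starM ss sd sdc.
have sy : star y = y by rewrite /y starM starB star1 starM ss sd comm_d_y.
have xy : x * y = y * x.
  rewrite /x /y mulrnAl mulrnAr; congr (_ *+ 2).
  by rewrite -mulrA (mulrA d) comm_d_y !mulrA comm_s_y -!mulrA; congr (_ * _); rewrite !mulrA -sdc.
have xy1 : x * x + y * y = 1.
  have -> : x * x = (s * s) *+ 4 * (d * d).
    by rewrite /x !mulrnAl !mulrnAr -mulrnA -!mulrA; congr (_ *+ _); congr (_ * _); rewrite !mulrA -sdc.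
  have -> : y * y = (1 - s * s) * (1 - s * s) * (d * d).
    by rewrite /y -!mulrA; congr (_ * _); rewrite mulrA comm_d_y mulrA.
  rewrite -mulrDl.
  have -> : (s * s) *+ 4 + (1 - s * s) * (1 - s * s) = k * k.
    rewrite /k; set u := s * s.
    rewrite mulrBl !mulrBr mulrDl !mulrDr !mul1r !mulr1 opprB.
    rewrite (addrC u (u * u)) [1 - u + _]addrACA [1 + u + _]addrACA -opprD.
    have -> : u *+ 4 = u + u + (u + u) by rewrite -addrA !mulrS mulr0n addr0.
    by set v := u + u; rewrite [LHS]addrCA addrK.
  by rewrite -mulrA (mulrA k d) kd mul1r kd.
have x1 := circle_norm sx sy xy xy1.
have y1 : cnorm y <= 1.
  by apply: (circle_norm sy sx (esym xy)); rewrite addrC.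
exists d; split=> //.
  have -> : d = (2^-1)%:C *: (1 + y).
    rewrite -[LHS]scale_half; congr (_ *: _).
    by rewrite /y mulrBl mul1r -[1 in RHS]kd /k mulrDl mul1r addrACA addrN addr0.
  rewrite cnormZr ger0_norm ?invr_ge0 //.
  by have := cnormD_le 1 y; rewrite cnorm1; lra.
rewrite -[s * d]scale_half -mulr2n cnormZr ger0_norm ?invr_ge0 //.
by rewrite -/x; lra.
Qed.

Definition re_part x := (2^-1)%:C *: (x + star x).
Definition im_part x := (2^-1)%:C *: - ('i *: (x - star x)).

Lemma re_part_selfadjoint x : star (re_part x) = re_part x.
Proof. by rewrite starZr starD starK addrC. Qed.

Lemma im_part_selfadjoint x : star (im_part x) = im_part x.
Proof. by rewrite starZr starN starZi starB starK opprK -opprB scalerN. Qed.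

Lemma re_im_part x : x = re_part x + 'i *: im_part x.
Proof.
rewrite /im_part scalerA mulrC -scalerA scalerN scalerA mulii scaleN1r opprK -scalerDr.
by rewrite addrACA subrr addr0 scale_half.
Qed.

End SelfAdjoint.

(** * *-homomorphisms *)

Section StarHomomorphisms.
Variables (R : realType) (A B : cstarAlgType R).
Implicit Types (f g : {lrmorphism A -> B}) (a s : A).

(** Circle relations are preserved by [f], which gives the bound for self-adjoint elements of norm
    below 1. Rescaling by a number strictly between [cnorm s] and [cnorm (f s)] gives it for all
    self-adjoint ones, and the C*-identity for the rest. *)
Lemma star_hom_norm_le f a : star_hom f -> cnorm (f a) <= cnorm a.
Proof.
move=> fs.
have unit_ball s : star s = s -> cnorm s < 1 -> cnorm (f s) <= 1.
  move=> ss s1; have [c [sc scc sc1]] := circle_complete ss s1.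
  apply: (circle_norm (c := f c)); rewrite -?fs ?ss ?sc -?rmorphM ?scc //.
  by rewrite -rmorphD sc1 rmorph1.
have selfadj s : star s = s -> cnorm (f s) <= cnorm s.
  move=> ss; rewrite leNgt; apply/negP => lt.
  pose t := (cnorm s + cnorm (f s)) / 2.
  have [st tf] : cnorm s < t /\ t < cnorm (f s) by rewrite /t; split; lra.
  have t0 : 0 < t := le_lt_trans (cnorm_ge0 s) st.
  have := unit_ball (t^-1%:C *: s); rewrite starZr ss linearZ /= !cnormZr.
  rewrite ger0_norm ?invr_ge0 ?(ltW t0) // mulrC ltr_pdivrMr // mul1r => /(_ erefl st).
  by rewrite mulrC ler_pdivrMr // mul1r leNgt tf.
rewrite -(ler_pXn2r (n := 2)) ?nnegrE ?cnorm_ge0 //.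
by rewrite -!cnorm_starM -fs -rmorphM selfadj // starM starK.
Qed.

Lemma limit_star_hom f u l : star_hom f -> limit_of u l -> limit_of (f \o u) (f l).
Proof.
move=> fs ul; apply: (limit_dominated (C := 1) ul) => m /=.
by rewrite -rmorphB mul1r star_hom_norm_le.
Qed.

(* [s' = s (1 + t^2)^-1] with [t = s / (2 r)] differs from [s] in third order. *)
Lemma truncate_selfadjoint f s (r : R) : star_hom f -> star s = s -> 0 < r ->
  cnorm (f s) <= r -> exists s', cnorm s' <= r /\ cnorm (f s - f s') <= r / 4.
Proof.
move=> fs ss r0 fsr; pose k := (2 * r)^-1; have k0 : 0 < k by rewrite invr_gt0; lra.
have k'0 : 0 <= k^-1 by rewrite invr_ge0 ltW.
pose t := k%:C *: s; have st : star t = t by rewrite starZr ss.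
have [d [sd tdc td d1 tdn]] := resolvent_bound st.
have kE : (k^-1)%:C *: t = s.
  by rewrite scalerA -rmorphM mulVf ?lt0r_neq0 // rmorph1 scale1r.
exists (k^-1%:C *: (t * d)); split.
  rewrite cnormZr ger0_norm //.
  apply: le_trans (ler_wpM2l k'0 tdn) _.
  by rewrite invrK; lra.
rewrite -(rmorphB f) -{1}kE -scalerBr.
have -> : t - t * d = t * t * (t * d).
  rewrite -{1}[t]mulr1 -mulrBr -td (mulrDr d) mulr1 addrAC subrr add0r.
  by rewrite -!mulrA; congr (_ * _); rewrite !mulrA -tdc -!mulrA; congr (_ * _); rewrite tdc.
rewrite /= linearZ /= cnormZr ger0_norm //.
have ft : cnorm (f t) <= 2^-1.
  rewrite /t linearZ /= cnormZr ger0_norm ?(ltW k0) //.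
  apply: le_trans (ler_wpM2l (ltW k0) fsr) _.
  by rewrite /k -subr_ge0 (_ : _ - _ = 0) //; field; rewrite lt0r_neq0.
have fd : cnorm (f d) <= 1 by apply: le_trans (star_hom_norm_le _ fs) d1.
have ftt : cnorm (f t * f t) <= 4^-1.
  apply: le_trans (cnormM_le _ _) _.
  by have := ler_pM (cnorm_ge0 _) (cnorm_ge0 _) ft ft; lra.
have ftd : cnorm (f t * f d) <= 2^-1.
  apply: le_trans (cnormM_le _ _) _.
  by have := ler_pM (cnorm_ge0 _) (cnorm_ge0 _) ft fd; lra.
rewrite !rmorphM.
have : cnorm (f t * f t * (f t * f d)) <= 8^-1.
  apply: le_trans (cnormM_le _ _) _.
  by have := ler_pM (cnorm_ge0 _) (cnorm_ge0 _) ftt ftd; lra.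
move=> /(ler_wpM2l k'0) /le_trans; apply.
by rewrite invrK; lra.
Qed.

(** The real and imaginary parts are truncated separately, which doubles both bounds of the
    self-adjoint case. *)
Lemma truncate f a (r : R) : star_hom f -> 0 < r -> cnorm (f a) <= r ->
  exists a', cnorm a' <= 2 * r /\ cnorm (f a - f a') <= r / 2.
Proof.
move=> fs r0 far; pose h := (2^-1)%:C : R[i].
have sx := re_part_selfadjoint a; have sy := im_part_selfadjoint a; have aE := re_im_part a.
set x := re_part a in sx aE; set y := im_part a in sy aE.
have half b : cnorm b <= r -> cnorm (h *: (b + star b)) <= r.
  move=> br; rewrite cnormZr ger0_norm ?invr_ge0 //.
  by have := cnormD_le b (star b); rewrite cnorm_star; lra.
have fx : cnorm (f x) <= r.
  by rewrite /x /re_part linearZ /= rmorphD /= fs half.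
have fy : cnorm (f y) <= r.
  have -> : y = h *: (- ('i *: a) + star (- ('i *: a))).
    by rewrite starN starZi opprK /y /im_part scalerBr opprB addrC.
  by rewrite linearZ /= rmorphD /= fs half // rmorphN /= linearZ /= cnormN cnormZ normc_i mul1r.
have [x' [x'r fx']] := truncate_selfadjoint fs sx r0 fx.
have [y' [y'r fy']] := truncate_selfadjoint fs sy r0 fy.
exists (x' + 'i *: y'); split.
  by have := cnormD_le x' ('i *: y'); rewrite cnormZ normc_i; lra.
have fE u v : f (u + 'i *: v) = f u + 'i *: f v by rewrite linearD linearZ.
rewrite aE !fE opprD addrACA -scalerBr.
by have := cnormD_le (f x - f x') ('i *: (f y - f y')); rewrite cnormZ normc_i; lra.
Qed.

(** As in the open mapping theorem, corrections are added to an approximate preimage. [truncate]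
    keeps each correction comparable in norm to the current error, so that they form a convergent
    series. *)
Lemma star_hom_closed_range f b : star_hom f ->
  (forall eps : R, 0 < eps -> exists a, cnorm (b - f a) < eps) ->
  exists a, f a = b.
Proof.
move=> fs cl; pose r := cnorm b + 1; have r0 : 0 < r by have := cnorm_ge0 b; rewrite /r; lra.
(* With error [rk] and an image within [rk / 8] of [b], truncation at [9 / 8 * rk] costs at most
   [9 / 16 * rk]: the new error is at most [11 / 16 * rk], below [3 / 4 * rk]. *)
pose q : R := 3 / 4; have q01 : 0 <= q < 1 by rewrite /q; apply/andP; split; lra.
have q0 : 0 < q by rewrite /q; lra.
(* The implication stands below the existential quantifier so that [choice] returns a total function
   of [k] and [x]. *)
have step k x : exists x', cnorm (b - f x) <= r * q ^+ k ->
    cnorm (b - f x') <= r * q ^+ k.+1 /\ cnorm (x' - x) <= (3 * r) * q ^+ k.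
  have rk0 : 0 < r * q ^+ k by rewrite mulr_gt0 ?exprn_gt0.
  set rk := r * q ^+ k in rk0 *.
  have [a ha] := cl (rk / 8) ltac:(lra).
  have [le|nle] := boolP (cnorm (b - f x) <= rk); last by exists x => h; case/negP: nle.
  have fax : cnorm (f (a - x)) <= 9 / 8 * rk.
    rewrite rmorphB; have := cnormB_trans b (f a) (f x); rewrite (cnormBC (f a) b); lra.
  have [a' [a'n a'f]] := truncate (r := 9 / 8 * rk) fs ltac:(lra) fax.
  exists (x + a') => _; split; last by rewrite addrAC subrr add0r -mulrA -/rk; lra.
  rewrite exprSr mulrA -/rk.
  have -> : b - f (x + a') = (b - f a) + (f (a - x) - f a').
    by rewrite rmorphD rmorphB -addrA -(addrA (f a)) addKr opprD.
  by have := cnormD_le (b - f a) (f (a - x) - f a'); rewrite /q; lra.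
have [g gP] := choice (fun kx => step kx.1 kx.2).
pose x := fix x k := if k is k'.+1 then g (k', x k') else 0.
have xP k : cnorm (b - f (x k)) <= r * q ^+ k.
  elim: k => [|k IH]; last by have [] := gP (k, x k) IH.
  by rewrite rmorph0 subr0 expr0 mulr1 /r; lra.
have [a xa] : exists a, limit_of x a.
  by apply: (geometric_limit q01) => k; exact: (proj2 (gP (k, x k) (xP k))).
exists a; apply: (limit_unique (limit_star_hom fs xa)) => e e0.
have [N HN] := geometric_bound r q01 e0; exists N => m /HN; apply: le_lt_trans.
by rewrite cnormBC xP.
Qed.

Lemma star_hom_onto f (S : B -> Prop) : star_hom f -> generated_by S ->
  (forall b, S b -> exists a, f a = b) -> forall b, exists a, f a = b.
Proof.
move=> fs gS hS; apply: gS => //.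
- by exists 1; rewrite rmorph1.
- by move=> _ _ [a <-] [b <-]; exists (a + b); rewrite rmorphD.
- by move=> c _ [a <-]; exists (c *: a); rewrite linearZ.
- by move=> _ _ [a <-] [b <-]; exists (a * b); rewrite rmorphM.
- by move=> _ [a <-]; exists (star a); rewrite fs.
- move=> b hb; apply: star_hom_closed_range => // e /hb[_ [a <-] ?]; by exists a.
Qed.

Lemma star_hom_eq f g (S : A -> Prop) : star_hom f -> star_hom g ->
  generated_by S -> (forall a, S a -> f a = g a) -> forall a, f a = g a.
Proof.
move=> fs gs gS hS; apply: gS => //.
- by rewrite !rmorph1.
- by move=> a b ha hb; rewrite !rmorphD /= ha hb.
- by move=> c a ha; rewrite !linearZ /= ha.
- by move=> a b ha hb; rewrite !rmorphM /= ha hb.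
- by move=> a ha; rewrite fs gs ha.
- move=> a ha; apply/eqP; rewrite -subr_eq0; apply/eqP/small_norm_eq0 => e e0.
  have [b hb ab] := ha (e / 2) ltac:(lra).
  have := cnormB_trans (f b) (f a) (g a); rewrite -rmorphB hb -rmorphB.
  have := star_hom_norm_le (a - b) fs; have := star_hom_norm_le (b - a) gs.
  by rewrite (cnormBC b); lra.
Qed.

End StarHomomorphisms.

(** * Universal C*-algebras *)

Section Presentations.
Variables (R : realType) (I : Type).

Inductive star_term :=
| Gen of I | One | Add of star_term & star_term | Scale of R[i] & star_term
| Mul of star_term & star_term | Star of star_term.

Fixpoint eval (Z : cstarAlgType R) (z : I -> Z) (t : star_term) : Z :=
  match t with
  | Gen i => z i
  | One => 1
  | Add t1 t2 => eval z t1 + eval z t2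
  | Scale c t1 => c *: eval z t1
  | Mul t1 t2 => eval z t1 * eval z t2
  | Star t1 => star (eval z t1)
  end.

(** Boundedness makes the supremum over all representations finite; inhabitation makes the universal
    algebra nonzero. That the relation holds in the universal algebra itself is proved separately
    for each use. *)
Record relations := Relations {
  rel :> forall Z : cstarAlgType R, (I -> Z) -> Prop;
  rel_bounded : forall (Z : cstarAlgType R) (z : I -> Z) i, rel z -> cnorm (z i) <= 1;
  rel_inhabited : exists Z : cstarAlgType R, exists z : I -> Z, rel z
}.

Record representation (P : relations) := Representation {
  rep_alg : cstarAlgType R;
  rep_gen : I -> rep_alg;
  rep_rel : P _ rep_gen
}.

End Presentations.

(** * The universal algebra as a completion of *-polynomials *)

Section UniversalAlgebra.
Variables (R : realType) (I : Type) (P : relations R I).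
Local Notation rep := (representation P).
Local Notation teval r := (eval (rep_gen r)).

Definition approximable (xi : forall r : rep, rep_alg r) :=
  forall eps : R, 0 < eps ->
    exists t : star_term R I, forall r, cnorm (xi r - (teval r t)) < eps.

(* Families indexed by all representations are too large to be the elements
   of a C*-algebra over which representations range; an approximable family is
   however determined by which terms are close to it. *)
Definition code (xi : forall r : rep, rep_alg r) (p : R * star_term R I) : Prop :=
  forall r, cnorm (xi r - (teval r p.2)) < p.1.

Definition univ : Type :=
  {c : R * star_term R I -> Prop | exists xi, approximable xi /\ c = code xi}.

Definition uval (x : univ) : forall r : rep, rep_alg r := projT1 (cid (proj2_sig x)).

Lemma uval_approx x : approximable (uval x).
Proof. by rewrite /uval; case: cid => xi []. Qed.

(** A term uniformly close to [xi] lies in the common code, hence is equally close to [zeta]. *)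
Lemma code_inj xi zeta : approximable xi -> code xi = code zeta -> forall r, xi r = zeta r.
Proof.
move=> axi E r; apply/eqP; rewrite -subr_eq0; apply/eqP/small_norm_eq0 => e e0.
have [t ht] := axi (e / 2) ltac:(lra).
have h1 : code xi (e / 2, t) by [].
have h2 : code zeta (e / 2, t) by rewrite -E.
have := cnormB_trans (teval r t) (xi r) (zeta r); rewrite (cnormBC (teval r t)).
by have := h1 r; have := h2 r => /=; lra.
Qed.

Lemma univ_ext (x y : univ) : (forall r, uval x r = uval y r) -> x = y.
Proof.
case: x y => [c hc] [c' hc'] h.
suff E : c = c' by subst c'; congr exist; exact: Prop_irrelevance.
move: h; rewrite /uval; case: cid => xi [_ /= ->]; case: cid => zeta [_ /= ->] h.
by congr code; apply: functional_extensionality_dep.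
Qed.

Definition mk xi (h : approximable xi) : univ :=
  exist _ (code xi) (ex_intro _ xi (conj h erefl)).

Lemma mkE xi (h : approximable xi) r : uval (mk h) r = xi r.
Proof.
rewrite /uval; case: cid => zeta [az /= E]; apply/esym; exact: code_inj.
Qed.

Lemma eval_bounded (t : star_term R I) : exists C : R, forall r : rep, cnorm (teval r t) <= C.
Proof.
elim: t => [i||t [C h] s [D k]|c t [C h]|t [C h] s [D k]|t [C h]].
- by exists 1 => r; apply: rel_bounded (rep_rel r).
- by exists 1 => r /=; rewrite cnorm1.
- by exists (C + D) => r /=; apply: le_trans (cnormD_le _ _) (lerD (h r) (k r)).
- by exists (normc c * C) => r /=; rewrite cnormZ ler_wpM2l // normc_ge0.
- by exists (C * D) => r /=; apply: le_trans (cnormM_le _ _) (ler_pM _ _ (h r) (k r)); rewrite cnorm_ge0.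
- by exists C => r /=; rewrite cnorm_star.
Qed.

Lemma approx_bounded xi : approximable xi -> exists2 C : R, 0 < C & forall r, cnorm (xi r) <= C.
Proof.
move=> /(_ 1 ltr01)[t ht]; have [C hC] := eval_bounded t.
exists (`|C| + 1) => [|r]; first by have := normr_ge0 C; lra.
have := cnormD_le (xi r - (teval r t)) (teval r t); rewrite subrK => /le_trans; apply.
by rewrite addrC lerD ?(ltW (ht r)) //; apply: le_trans (hC r) (ler_norm _).
Qed.

Lemma approx_term t : approximable (fun r => (teval r t)).
Proof. by move=> e e0; exists t => r; rewrite subrr cnorm0. Qed.

Lemma approx_add xi zeta : approximable xi -> approximable zeta ->
  approximable (fun r => xi r + zeta r).
Proof.
move=> h k e e0; have [t ht] := h (e / 2) ltac:(lra).
have [s hs] := k (e / 2) ltac:(lra); exists (Add t s) => r /=.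
rewrite opprD addrACA; apply: le_lt_trans (cnormD_le _ _) _.
by have := ht r; have := hs r; lra.
Qed.

Lemma approx_scale c xi : approximable xi -> approximable (fun r => c *: xi r).
Proof.
move=> h e e0; have c1 : 0 < normc c + 1 by have := normc_ge0 c; lra.
have [t ht] := h (e / (normc c + 1)) ltac:(by rewrite divr_gt0).
exists (Scale c t) => r /=; rewrite -scalerBr cnormZ.
have := ht r; rewrite ltr_pdivlMr // => hr; apply: le_lt_trans hr.
by rewrite mulrC ler_wpM2l ?cnorm_ge0 // lerDl.
Qed.

Lemma approx_mul xi zeta : approximable xi -> approximable zeta ->
  approximable (fun r => xi r * zeta r).
Proof.
move=> h k e e0; have [C C0 hC] := approx_bounded k.
have [t ht] := h (e / 2 / C) ltac:(by rewrite !divr_gt0).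
have [D hD] := eval_bounded t; have D0 : 0 < `|D| + 1 by have := normr_ge0 D; lra.
have [s hs] := k (e / 2 / (`|D| + 1)) ltac:(by rewrite !divr_gt0).
exists (Mul t s) => r /=.
have -> : xi r * zeta r - (teval r t) * (teval r s) = (xi r - (teval r t)) * zeta r + (teval r t) * (zeta r - (teval r s)).
  by rewrite mulrBl mulrBr addrA subrK.
apply: le_lt_trans (cnormD_le _ _) _.
have h1 : cnorm ((xi r - (teval r t)) * zeta r) < e / 2.
  apply: le_lt_trans (cnormM_le _ _) _; have := ht r; rewrite ltr_pdivlMr //.
  by apply: le_lt_trans; rewrite ler_wpM2l ?cnorm_ge0.
have h2 : cnorm ((teval r t) * (zeta r - (teval r s))) < e / 2.
  apply: le_lt_trans (cnormM_le _ _) _; have := hs r; rewrite ltr_pdivlMr // mulrC.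
  apply: le_lt_trans; rewrite ler_wpM2r ?cnorm_ge0 //.
  by apply: le_trans (hD r) _; have := ler_norm D; lra.
by lra.
Qed.

Lemma approx_star xi : approximable xi -> approximable (fun r => star (xi r)).
Proof.
by move=> h e /h[t ht]; exists (Star t) => r /=; rewrite -starB cnorm_star.
Qed.

Lemma approx_limit xi : (forall e : R, 0 < e -> exists2 zeta, approximable zeta &
  forall r, cnorm (xi r - zeta r) < e) -> approximable xi.
Proof.
move=> h e e0; have [z az hz] := h (e / 2) ltac:(lra).
have [t ht] := az (e / 2) ltac:(lra); exists t => r.
apply: le_lt_trans (cnormB_trans (z r) _ _) _.
by have := hz r; have := ht r; lra.
Qed.

Definition uterm t : univ := mk (approx_term t).
Definition uscale c x : univ := mk (approx_scale c (uval_approx x)).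
Definition uone := uterm (One R I).
Definition uzero := uscale 0 uone.
Definition uopp := uscale (-1).
Definition uadd x y : univ := mk (approx_add (uval_approx x) (uval_approx y)).
Definition umul x y : univ := mk (approx_mul (uval_approx x) (uval_approx y)).
Definition ustar x : univ := mk (approx_star (uval_approx x)).
Definition ugen i : univ := uterm (Gen R i).

Lemma uval0 r : uval uzero r = 0. Proof. by rewrite mkE scale0r. Qed.
Lemma uvalN x r : uval (uopp x) r = - uval x r. Proof. by rewrite mkE scaleN1r. Qed.
Definition uvalE := (uval0, uvalN, mkE).

HB.instance Definition _ := gen_eqMixin univ.
HB.instance Definition _ := gen_choiceMixin univ.

Lemma uaddA : associative uadd.
Proof. by move=> x y z; apply: univ_ext => r; rewrite !uvalE addrA. Qed.
Lemma uaddC : commutative uadd.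
Proof. by move=> x y; apply: univ_ext => r; rewrite !uvalE addrC. Qed.
Lemma uadd0 : left_id uzero uadd.
Proof. by move=> x; apply: univ_ext => r; rewrite uvalE uval0 add0r. Qed.
Lemma uaddN : left_inverse uzero uopp uadd.
Proof. by move=> x; apply: univ_ext => r; rewrite uval0 uvalE uvalN addNr. Qed.

HB.instance Definition _ := GRing.isZmodule.Build univ uaddA uaddC uadd0 uaddN.

Lemma umulA : associative umul.
Proof. by move=> x y z; apply: univ_ext => r; rewrite !mkE mulrA. Qed.
Lemma umul1 : left_id uone umul.
Proof. by move=> x; apply: univ_ext => r; rewrite !mkE mul1r. Qed.
Lemma umulr1 : right_id uone umul.
Proof. by move=> x; apply: univ_ext => r; rewrite !mkE mulr1. Qed.
Lemma umulDl : left_distributive umul uadd.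
Proof. by move=> x y z; apply: univ_ext => r; rewrite !mkE mulrDl. Qed.
Lemma umulDr : right_distributive umul uadd.
Proof. by move=> x y z; apply: univ_ext => r; rewrite !mkE mulrDr. Qed.
Lemma uone_neq0 : uone != uzero.
Proof.
apply/eqP => /(congr1 uval) E.
have [Z [z Pz]] := rel_inhabited P; have := congr1 (fun v => v (Representation Pz)) E.
by rewrite uval0 mkE /= => /eqP; rewrite oner_eq0.
Qed.

HB.instance Definition _ := GRing.Zmodule_isNzRing.Build univ
  umulA umul1 umulr1 umulDl umulDr uone_neq0.

Lemma uscaleA (a b : R[i]) x : uscale a (uscale b x) = uscale (a * b) x.
Proof. by apply: univ_ext => r; rewrite !mkE scalerA. Qed.
Lemma uscale1 : left_id 1 uscale.
Proof. by move=> x; apply: univ_ext => r; rewrite !mkE scale1r. Qed.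
Lemma uscaleDr : right_distributive uscale +%R.
Proof. by move=> c x y; apply: univ_ext => r; rewrite !mkE scalerDr. Qed.
Lemma uscaleDl x : {morph uscale^~ x : a b / a + b}.
Proof. by move=> a b; apply: univ_ext => r; rewrite !mkE scalerDl. Qed.

HB.instance Definition _ := GRing.Zmodule_isLmodule.Build R[i] univ
  uscaleA uscale1 uscaleDr uscaleDl.

Lemma uscaleAl (c : R[i]) (x y : univ) : c *: (x * y) = c *: x * y.
Proof. by apply: univ_ext => r; rewrite !mkE scalerAl. Qed.

HB.instance Definition _ := GRing.Lmodule_isLalgebra.Build R[i] univ uscaleAl.

Lemma uscaleAr (c : R[i]) (x y : univ) : c *: (x * y) = x * (c *: y).
Proof. by apply: univ_ext => r; rewrite !mkE scalerAr. Qed.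

HB.instance Definition _ := GRing.Lalgebra_isAlgebra.Build R[i] univ uscaleAr.

Lemma uvalB (x y : univ) r : uval (x - y) r = uval x r - uval y r.
Proof. by rewrite mkE uvalN. Qed.

(** A supremum of a set of reals, so that ranging over all representations raises no size issue. *)
Definition unorm (x : univ) : R := sup [set a | exists r, a = cnorm (uval x r)]%classic.

Lemma uval_le x r : cnorm (uval x r) <= unorm x.
Proof.
apply: ub_le_sup; last by exists r.
have [C _ hC] := approx_bounded (uval_approx x); exists C => _ [s ->]; exact: hC.
Qed.

Lemma unorm_le x (C : R) : (forall r, cnorm (uval x r) <= C) -> unorm x <= C.
Proof.
move=> h; apply: ge_sup; last by move=> _ [r ->].
by have [Z [z Pz]] := rel_inhabited P; exists (cnorm (uval x (Representation Pz))), (Representation Pz).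
Qed.

Lemma unorm_ge0 x : 0 <= unorm x.
Proof.
have [Z [z Pz]] := rel_inhabited P.
exact: le_trans (cnorm_ge0 _) (uval_le x (Representation Pz)).
Qed.

Lemma unorm0_eq0 x : unorm x = 0 -> x = 0.
Proof.
move=> x0; apply: univ_ext => r; rewrite uval0; apply: cnorm0_eq0; apply/eqP.
by rewrite eq_le cnorm_ge0 andbT -x0 uval_le.
Qed.

Lemma unormD x y : unorm (x + y) <= unorm x + unorm y.
Proof.
by apply: unorm_le => r; rewrite mkE; apply: le_trans (cnormD_le _ _) (lerD (uval_le _ _) (uval_le _ _)).
Qed.

Lemma unormZ_le c x : unorm (c *: x) <= normc c * unorm x.
Proof.
by apply: unorm_le => r; rewrite mkE cnormZ ler_wpM2l ?normc_ge0 // uval_le.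
Qed.

Lemma unormZ c x : unorm (c *: x) = normc c * unorm x.
Proof.
apply/eqP; rewrite eq_le unormZ_le /=.
have [->|c0] := eqVneq c 0; first by rewrite normc0 mul0r unorm_ge0.
have nc : 0 < normc c by rewrite lt_def normc_ge0 andbT; apply: contra c0 => /eqP/eq0_normc ->.
rewrite mulrC -ler_pdivlMr // mulrC; have := unormZ_le c^-1 (c *: x).
by rewrite scalerA mulVf // scale1r normcV.
Qed.

Lemma unormM x y : unorm (x * y) <= unorm x * unorm y.
Proof.
apply: unorm_le => r; rewrite mkE; apply: le_trans (cnormM_le _ _) _.
by rewrite ler_pM ?cnorm_ge0 ?uval_le.
Qed.

Lemma unorm_starM x : unorm (ustar x * x) = unorm x ^+ 2.
Proof.
apply/eqP; rewrite eq_le; apply/andP; split.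
  by apply: unorm_le => r; rewrite !mkE cnorm_starM lerXn2r ?nnegrE ?cnorm_ge0 ?unorm_ge0 ?uval_le.
rewrite -[leRHS]sqr_sqrtr ?unorm_ge0 // lerXn2r ?nnegrE ?unorm_ge0 ?sqrtr_ge0 //.
apply: unorm_le => r; rewrite -[leLHS]ger0_norm ?cnorm_ge0 // -sqrtr_sqr ler_wsqrtr //.
by rewrite -cnorm_starM; have := uval_le (ustar x * x) r; rewrite !mkE.
Qed.

(** Limits are taken in each representation; the Cauchy condition is uniform in the representation,
    so the convergence is uniform too and the limit stays approximable. *)
Lemma univ_complete (u : nat -> univ) :
  (forall eps : R, 0 < eps -> exists N : nat, forall m k : nat,
     (N <= m)%N -> (N <= k)%N -> unorm (u m - u k) < eps) ->
  exists l : univ, forall eps : R, 0 < eps -> exists N : nat, forall m : nat,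
     (N <= m)%N -> unorm (u m - l) < eps.
Proof.
move=> uC.
have lim r : exists l, limit_of (fun m => uval (u m) r) l.
  apply: cnorm_complete => e /uC[N HN]; exists N => m k Nm Nk.
  by rewrite -uvalB; apply: le_lt_trans (uval_le _ _) (HN m k Nm Nk).
pose xi r := projT1 (cid (lim r)).
have xiP r : limit_of (fun m => uval (u m) r) (xi r) := projT2 (cid (lim r)).
have close e : 0 < e -> exists N, forall m, (N <= m)%N -> forall r, cnorm (uval (u m) r - xi r) <= e.
  move=> e0; have [N HN] := uC (e / 2) ltac:(lra); exists N => m Nm r.
  have [N' HN'] := xiP r (e / 2) ltac:(lra); pose k := maxn N N'.
  have h1 := HN m k Nm (leq_maxl _ _); have h2 := HN' k (leq_maxr _ _).
  apply: le_trans (cnormB_trans (uval (u k) r) _ _) _.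
  by have := uval_le (u m - u k) r; rewrite uvalB; lra.
have axi : approximable xi.
  apply: approx_limit => e e0; have [N HN] := close (e / 2) ltac:(lra).
  exists (uval (u N)); first exact: uval_approx.
  by move=> r; rewrite cnormBC; apply: le_lt_trans (HN N (leqnn N) r) _; lra.
exists (mk axi) => e e0; have [N HN] := close (e / 2) ltac:(lra).
exists N => m Nm; apply: (@le_lt_trans _ _ (e / 2)); last by lra.
by apply: unorm_le => r; rewrite uvalB mkE HN.
Qed.

Lemma ustarK : involutive ustar.
Proof. by move=> x; apply: univ_ext => r; rewrite !mkE starK. Qed.
Lemma ustarD : {morph ustar : x y / x + y}.
Proof. by move=> x y; apply: univ_ext => r; rewrite !mkE starD. Qed.
Lemma ustarZ (c : R[i]) (x : univ) : ustar (c *: x) = c^* *: ustar x.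
Proof. by apply: univ_ext => r; rewrite !mkE starZ. Qed.
Lemma ustarM (x y : univ) : ustar (x * y) = ustar y * ustar x.
Proof. by apply: univ_ext => r; rewrite !mkE starM. Qed.

HB.instance Definition _ := isUnitalCStarAlgebra.Build R univ
  ustarK ustarD ustarZ ustarM unorm0_eq0 unormD unormZ unormM unorm_starM univ_complete.

Definition rep_map (r : rep) (x : univ) : rep_alg r := uval x r.

Lemma rep_map_linear r : linear (rep_map r).
Proof. by move=> c x y; rewrite /rep_map !mkE. Qed.
HB.instance Definition _ r := GRing.isLinear.Build R[i] univ (rep_alg r) _ (rep_map r)
  (rep_map_linear r).

Lemma rep_map_monoid r : monoid_morphism (rep_map r).
Proof. by split=> [|x y]; rewrite /rep_map !mkE. Qed.
HB.instance Definition _ r := GRing.isMonoidMorphism.Build univ (rep_alg r) (rep_map r)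
  (rep_map_monoid r).

Lemma rep_map_star r : star_hom (rep_map r : {lrmorphism univ -> rep_alg r}).
Proof. by move=> x; rewrite /= /rep_map mkE. Qed.

Lemma rep_map_gen r i : rep_map r (ugen i) = rep_gen r i.
Proof. exact: mkE. Qed.

Lemma rep_map_inj (x y : univ) : (forall r, rep_map r x = rep_map r y) -> x = y.
Proof. exact: univ_ext. Qed.

(** Evaluating a term at the generators of [univ] is evaluating it in every representation, so
    approximability says exactly that such values are dense. *)
Lemma univ_generated : generated_by (fun a : univ => exists i, a = ugen i).
Proof.
move=> Q Qg Q1 QD QZ QM QS Qcl x; apply: Qcl => e e0.
have [t ht] := uval_approx x (ltac:(lra) : 0 < e / 2).
have evalE r : uval (eval (ugen : I -> (univ : cstarAlgType R)) t) r = (teval r t).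
  elim: t {ht} => [i||t1 IH1 t2 IH2|c t1 IH1|t1 IH1 t2 IH2|t1 IH1] /=; rewrite ?mkE ?IH1 ?IH2 //=.
exists (eval (ugen : I -> (univ : cstarAlgType R)) t).
  by elim: t {ht evalE} => /=; auto=> i; apply: Qg; exists i.
apply: (@le_lt_trans _ _ (e / 2)); last by lra.
by apply: unorm_le => r; rewrite uvalB evalE ltW.
Qed.

End UniversalAlgebra.

(** * Quantum permutations *)

Section Projections.
Variables (R : realType) (A : cstarAlgType R).
Implicit Types p : A.

Lemma projection0 : projection (0 : A).
Proof. by rewrite /projection star0 mul0r. Qed.

Lemma projection1 : projection (1 : A).
Proof. by rewrite /projection star1 mulr1. Qed.

Lemma projection_nat (b : bool) : projection (b%:R : A).
Proof. by case: b; [exact: projection1|exact: projection0]. Qed.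

Lemma projectionC p : projection p -> projection (1 - p).
Proof.
case=> sp pp; split; first by rewrite starB star1 sp.
by rewrite mulrBl mul1r mulrBr mulr1 pp subrr subr0.
Qed.

Lemma cnorm_projection p : projection p -> cnorm p <= 1.
Proof.
case=> sp pp; rewrite leNgt; apply/negP => lt1.
have := cnorm_selfadjoint_sqr sp; rewrite pp expr2 => E.
have : cnorm p * 1 < cnorm p * cnorm p by rewrite ltr_pM2l //; lra.
by rewrite -E mulr1 ltxx.
Qed.

Lemma cnormMn p k : cnorm (p *+ k) = k%:R * cnorm p.
Proof.
by rewrite -scaler_nat -(rmorph_nat (real_complex R)) cnormZr ger0_norm ?ler0n.
Qed.

(* With [m] projections, [m - 1 + p j = \sum_(i != j) (1 - p i)] has norm at most
   [m - 1], but multiplies [p j] by [m]. *)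
Lemma projection_sum_eq0 (J : finType) (P : pred J) (p : J -> A) :
  (forall i, projection (p i)) -> \sum_(i | P i) p i = 0 ->
  forall j, P j -> p j = 0.
Proof.
move=> pp s0 j Pj; pose m := #|[pred i | P i && (i != j)]|.
pose h := \sum_(i | P i && (i != j)) (1 - p i).
have hE : h = 1 *+ m + p j.
  rewrite /h sumrB sumr_const; congr (_ + _).
  by apply/eqP; rewrite eq_sym -addr_eq0 -(bigD1 j) //= s0.
have hn : cnorm h <= m%:R.
  apply: le_trans (cnorm_sum _ _ _) _; rewrite -sumr_const ler_sum // => i _.
  exact: cnorm_projection (projectionC (pp i)).
have hp : h * p j = p j *+ m.+1.
  by rewrite hE mulrDl mulrnAl mul1r (pp j).2 mulrSr.
apply: small_norm_eq0 => e e0.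
have := cnormM_le h (p j); rewrite hp cnormMn.
have := ler_wpM2r (cnorm_ge0 (p j)) hn; rewrite -natr1 mulrDl mul1r => h1 h2.
by apply: ltW; apply: le_lt_trans e0; move: h1 h2; set a := m%:R * _; set b := _ * _; lra.
Qed.

End Projections.

Section QuantumPermutations.
Variables (R : realType) (n : nat) (G : simple_graph n).
Implicit Types (A B : cstarAlgType R) (S T : {set 'I_n}).

(** [S] only bounds the support from above: the class then contains the identity for every [S] and
    is stable under *-homomorphisms. *)
Definition quantum_permutation S A (U : 'M[A]_n) :=
  [/\ magic_unitary U, adapted G U &
      forall x y, (x \notin S) || (y \notin S) -> U x y = (x == y)%:R].

(** In a row or column whose diagonal entry is 1, the remaining projections sum to 0 and therefore
    vanish. *)
Lemma supported_on_Supp A (U : 'M[A]_n) : magic_unitary U -> adapted G U ->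
  quantum_permutation (Supp U) U.
Proof.
move=> mU aU; split=> // x y; have [pU rU cU] := mU.
have U1 z : z \notin Supp U -> U z z = 1 by rewrite inE negbK => /eqP.
have [<-|xy] := eqVneq x y; first by rewrite orbb => /U1.
case/orP => /U1 Uzz.
  have := rU x; rewrite (bigD1 x) //= Uzz -[in X in _ = X](addr0 1) => /addrI s0.
  by apply: (projection_sum_eq0 _ s0) => //; rewrite eq_sym.
have := cU y; rewrite (bigD1 y) //= Uzz -[in X in _ = X](addr0 1) => /addrI s0.
by apply: (projection_sum_eq0 (p := fun i => U i y) _ s0).
Qed.

Lemma quantum_permutation1 S A : quantum_permutation S (1%:M : 'M[A]_n).
Proof.
split; last by move=> x y _; rewrite mxE.
  split=> [i j|i|j]; first by rewrite mxE; exact: projection_nat.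
    by rewrite (bigD1 i) //= big1 ?addr0 ?mxE ?eqxx // => j /negPf ji; rewrite mxE eq_sym ji.
  by rewrite (bigD1 j) //= big1 ?addr0 ?mxE ?eqxx // => i /negPf ij; rewrite mxE ij.
by rewrite /adapted mul1mx mulmx1.
Qed.

Lemma map_adjacency A B (f : {lrmorphism A -> B}) :
  map_mx f (adjacency A G) = adjacency B G.
Proof. by apply/matrixP => i j; rewrite !mxE rmorph_nat. Qed.

Lemma quantum_permutation_map S A B (f : {lrmorphism A -> B}) (U : 'M[A]_n) :
  star_hom f -> quantum_permutation S U -> quantum_permutation S (map_mx f U).
Proof.
move=> fs [[pU rU cU] aU sU]; split.
- split=> [i j|i|j].
  + by have [h1 h2] := pU i j; rewrite mxE; split; rewrite -?fs -?rmorphM ?h1 ?h2.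
  + by under eq_bigr do rewrite mxE; rewrite -rmorph_sum rU rmorph1.
  + by under eq_bigr do rewrite mxE; rewrite -rmorph_sum cU rmorph1.
- by rewrite /adapted -(map_adjacency f) -!map_mxM aU.
- by move=> x y /sU; rewrite mxE => ->; rewrite rmorph_nat.
Qed.

(** Every clause is an equation between *-polynomials in the entries, so a jointly injective family
    of *-homomorphisms detects it. Applied to all representations, it shows that the universal
    generators satisfy their relations. *)
Lemma quantum_permutation_reflect S A (J : Type) (B : J -> cstarAlgType R)
    (f : forall j, {lrmorphism A -> B j}) (U : 'M[A]_n) :
  (forall j, star_hom (f j)) -> (forall a b, (forall j, f j a = f j b) -> a = b) ->
  (forall j, quantum_permutation S (map_mx (f j) U)) -> quantum_permutation S U.
Proof.
move=> fs inj fU; split.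
- split=> [i k|i|i].
  + split; apply: inj => j; have [[/(_ i k)[]]] := fU j; rewrite !mxE => h1 h2 _ _ _ _.
      by rewrite fs.
    by rewrite rmorphM.
  + apply: inj => j; have [[_ /(_ i) s1 _] _ _] := fU j.
    by rewrite rmorph1 -s1 rmorph_sum; apply: eq_bigr => k _; rewrite mxE.
  + apply: inj => j; have [[_ _ /(_ i) s1] _ _] := fU j.
    by rewrite rmorph1 -s1 rmorph_sum; apply: eq_bigr => k _; rewrite mxE.
- apply/matrixP => i k; apply: inj => j; have [_ aU _] := fU j.
  move: aU; rewrite /adapted -(map_adjacency (f j)) -!map_mxM => /matrixP/(_ i k).
  by rewrite [LHS]mxE [RHS]mxE.
- move=> x y xy; apply: inj => j; have [_ _ /(_ x y xy)] := fU j.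
  by rewrite mxE rmorph_nat.
Qed.

Definition glue S A (U V : 'M[A]_n) : 'M[A]_n :=
  \matrix_(x, y) if x \in S then U x y else V x y.

(** For [x] in [S] the factor [U x k] vanishes for [k] outside [S], and for [k] in [S] disjointness
    makes [V k y] a Kronecker delta. For [x] outside [S] only [k = x] contributes. *)
Lemma glueE S T A (U V : 'M[A]_n) : [disjoint S & T] ->
  quantum_permutation S U -> quantum_permutation T V -> glue S U V = U *m V.
Proof.
move=> ST [_ _ sU] [_ _ sV]; apply/matrixP => x y; rewrite !mxE.
have [xS|xS] := boolP (x \in S).
  rewrite (bigD1 y) //= big1 ?addr0 => [|k ky].
    have [yS|yS] := boolP (y \in S).
      by rewrite sV ?eqxx ?mulr1 // (disjointFr ST yS).
    rewrite sU ?yS ?orbT //; have [E|_] := eqVneq; last by rewrite mul0r.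
    by rewrite -E xS in yS.
  have [kS|kS] := boolP (k \in S).
    by rewrite (sV k) ?(negPf ky) ?mulr0 // (disjointFr ST kS).
  rewrite sU ?kS ?orbT //; have [E|_] := eqVneq; last by rewrite mul0r.
  by rewrite -E xS in kS.
rewrite (bigD1 x) //= big1 ?addr0 => [|k kx]; first by rewrite sU ?xS // eqxx mul1r.
by rewrite sU ?xS // eq_sym (negPf kx) mul0r.
Qed.

(** The two descriptions of the matrix complement each other: projections and row sums are read off
    [glue], column sums and adaptedness off the product. *)
Lemma glue_magic S T A (U V : 'M[A]_n) : [disjoint S & T] ->
  quantum_permutation S U -> quantum_permutation T V ->
  magic_unitary (glue S U V) /\ adapted G (glue S U V).
Proof.
move=> ST qU qV; have E := glueE ST qU qV.
have [[pU rU cU] aU _] := qU; have [[pV rV cV] aV _] := qV.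
split; last by rewrite E /adapted -mulmxA aV !mulmxA aU.
split=> [x y|x|y].
- by rewrite mxE; case: ifP.
- case xS: (x \in S); first by rewrite -[RHS](rU x); apply: eq_bigr => y _; rewrite mxE xS.
  by rewrite -[RHS](rV x); apply: eq_bigr => y _; rewrite mxE xS.
- rewrite E; under eq_bigr do rewrite mxE; rewrite exchange_big /= -[RHS](cV y).
  by apply: eq_bigr => k _; rewrite -mulr_suml cU mul1r.
Qed.

Lemma quantum_permutation_bounded S A (z : 'I_n * 'I_n -> A) i :
  quantum_permutation S (\matrix_(x, y) z (x, y)) -> cnorm (z i) <= 1.
Proof. by case: i => x y [[/(_ x y) + _ _] _ _]; rewrite mxE => /cnorm_projection. Qed.

Lemma quantum_permutation_inhabited S : exists (A : cstarAlgType R) (z : 'I_n * 'I_n -> A),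
  quantum_permutation S (\matrix_(x, y) z (x, y)).
Proof.
exists R[i]^o, (fun xy => (xy.1 == xy.2)%:R).
have -> : \matrix_(x, y) (x == y)%:R = 1%:M :> 'M[R[i]^o]_n.
  by apply/matrixP => x y; rewrite !mxE.
exact: quantum_permutation1.
Qed.

Definition qperm_relations S : relations R ('I_n * 'I_n) :=
  Relations (fun A z i => @quantum_permutation_bounded S A z i)
            (quantum_permutation_inhabited S).

(* With [S] the support of [U], this plays the part of [X']: it is represented by
   [U] and by the identity, hence nontrivial even if the entries of [U] are scalars. *)
Definition qperm S : cstarAlgType R := univ (qperm_relations S).

Definition qperm_gen S : 'M[qperm S]_n := \matrix_(x, y) ugen (qperm_relations S) (x, y).

Lemma qperm_genP S : quantum_permutation S (qperm_gen S).
Proof.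
apply: (quantum_permutation_reflect (f := fun r => rep_map r)) => [r|a b|r].
- exact: rep_map_star.
- exact: rep_map_inj.
- have := rep_rel r; congr quantum_permutation.
  by apply/matrixP => x y; rewrite !mxE /= rep_map_gen.
Qed.

Lemma qperm_generated S : generated_by (fun a => exists x y, a = qperm_gen S x y).
Proof.
move=> Q hQ; apply: (@univ_generated _ _ (qperm_relations S)) => a [[x y] ->].
by apply: hQ; exists x, y; rewrite mxE.
Qed.

Lemma qperm_universal S A (U : 'M[A]_n) : quantum_permutation S U ->
  exists2 f : {lrmorphism qperm S -> A}, star_hom f & forall x y, f (qperm_gen S x y) = U x y.
Proof.
move=> qU; pose z xy := U xy.1 xy.2.
have qz : qperm_relations S _ z.
  by rewrite /= (_ : \matrix_(_, _) _ = U) //; apply/matrixP => x y; rewrite mxE.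
exists (rep_map (Representation qz) : {lrmorphism _ -> _}).
  exact: (rep_map_star (Representation qz)).
by move=> x y; rewrite mxE /= rep_map_gen.
Qed.

(** For the full set the support condition is void. This provides the existence of C(Qu(G)). *)
Lemma qperm_setT_is_CQu : is_CQu G (qperm_gen [set: 'I_n]%SET).
Proof.
have [h1 h2 _] := qperm_genP [set: 'I_n]%SET; split=> //; first exact: qperm_generated.
by move=> Z w mw aw; apply: qperm_universal; split=> // x y; rewrite !inE.
Qed.

(** Were the algebra isomorphic to the complex numbers, its generators would be scalars, which
    unital homomorphisms preserve; the representations by [U] and by the identity would then
    coincide. *)
Lemma qperm_nontrivial S A (U : 'M[A]_n) : quantum_permutation S U -> U <> 1%:M ->
  nontrivial (qperm S).
Proof.
move=> qU U1; split; first by apply/eqP/oner_neq0.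
case=> phi [phis [psi phiK _]]; apply: U1.
have [f _ fE] := qperm_universal qU.
have [g _ gE] := qperm_universal (quantum_permutation1 S A).
have scalar a : a = (phi a : R[i]) *: 1.
  by rewrite -[LHS]phiK -[RHS]phiK; congr psi; rewrite linearZ rmorph1 /= /GRing.scale /= mulr1.
apply/matrixP => x y; rewrite -fE -gE [qperm_gen S x y]scalar !linearZ /=.
by rewrite !rmorph1.
Qed.

(** * The free product as a universal algebra, and as a quotient *)

Section FreeProduct.
Variables S T : {set 'I_n}.

Definition pair_relation A (z : bool * ('I_n * 'I_n) -> A) :=
  quantum_permutation S (\matrix_(x, y) z (true, (x, y))) /\
  quantum_permutation T (\matrix_(x, y) z (false, (x, y))).

Lemma pair_bounded A (z : bool * ('I_n * 'I_n) -> A) i : pair_relation z -> cnorm (z i) <= 1.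
Proof.
case: i => -[] [x y] [q1 q2].
  exact: (quantum_permutation_bounded (z := fun xy => z (true, xy)) (x, y) q1).
exact: (quantum_permutation_bounded (z := fun xy => z (false, xy)) (x, y) q2).
Qed.

Lemma pair_inhabited : exists (A : cstarAlgType R) (z : bool * ('I_n * 'I_n) -> A), pair_relation z.
Proof.
exists R[i]^o, (fun b => (b.2.1 == b.2.2)%:R).
have E : \matrix_(x, y) (x == y)%:R = 1%:M :> 'M[R[i]^o]_n.
  by apply/matrixP => x y; rewrite !mxE.
by rewrite /pair_relation /= E; split; exact: quantum_permutation1.
Qed.

Definition pair_relations : relations R (bool * ('I_n * 'I_n)) :=
  Relations pair_bounded pair_inhabited.

Definition qperm_pair : cstarAlgType R := univ pair_relations.

Definition pair_gen b : 'M[qperm_pair]_n := \matrix_(x, y) ugen pair_relations (b, (x, y)).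

Lemma pair_genP :
  quantum_permutation S (pair_gen true) /\ quantum_permutation T (pair_gen false).
Proof.
have E r b : map_mx (rep_map r) (pair_gen b) = \matrix_(x, y) rep_gen r (b, (x, y)).
  by apply/matrixP => x y; rewrite !mxE /= rep_map_gen.
split; apply: (quantum_permutation_reflect (f := fun r => rep_map r)) => [r|a b|r];
  try exact: rep_map_star; try exact: rep_map_inj.
  by have [] := rep_rel r; rewrite E.
by have [] := rep_rel r; rewrite E.
Qed.

Lemma pair_generated :
  generated_by (fun a => exists b x y, a = pair_gen b x y).
Proof.
move=> Q hQ; apply: (@univ_generated _ _ pair_relations) => a [[b [x y]] ->].
by apply: hQ; exists b, x, y; rewrite mxE.
Qed.

Lemma pair_universal A (U V : 'M[A]_n) : quantum_permutation S U -> quantum_permutation T V ->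
  exists2 f : {lrmorphism qperm_pair -> A}, star_hom f &
    (forall x y, f (pair_gen true x y) = U x y) /\ (forall x y, f (pair_gen false x y) = V x y).
Proof.
move=> qU qV; pose z (b : bool * ('I_n * 'I_n)) := if b.1 then U b.2.1 b.2.2 else V b.2.1 b.2.2.
have qz : pair_relations _ z.
  split; first by rewrite (_ : \matrix_(_, _) _ = U) //; apply/matrixP => x y; rewrite mxE.
  by rewrite (_ : \matrix_(_, _) _ = V) //; apply/matrixP => x y; rewrite mxE.
exists (rep_map (Representation qz) : {lrmorphism _ -> _}).
  exact: (rep_map_star (Representation qz)).
by split=> x y; rewrite mxE /= rep_map_gen.
Qed.

(** Both sides classify the same data: a pair of *-homomorphisms out of the factors amounts to a
    pair of quantum permutations, one for each support. *)
Lemma qperm_pair_free_product :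
  exists (iX : {lrmorphism qperm S -> qperm_pair}) (iY : {lrmorphism qperm T -> qperm_pair}),
    is_free_product iX iY.
Proof.
have [qS qT] := pair_genP.
have [iX iXs iXE] := qperm_universal qS; have [iY iYs iYE] := qperm_universal qT.
exists iX, iY; split=> // Z f g fs gs.
have [h hs [h1 h2]] := pair_universal (quantum_permutation_map fs (qperm_genP S))
                                      (quantum_permutation_map gs (qperm_genP T)).
exists h; split=> //.
- apply: (star_hom_eq (f := h \o iX : {lrmorphism _ -> _}) (g := f) _ fs (qperm_generated (S := S))).
    by move=> a /=; rewrite iXs hs.
  by move=> _ [x [y ->]] /=; rewrite iXE h1 mxE.
- apply: (star_hom_eq (f := h \o iY : {lrmorphism _ -> _}) (g := g) _ gs (qperm_generated (S := T))).
    by move=> a /=; rewrite iYs hs.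
  by move=> _ [x [y ->]] /=; rewrite iYE h2 mxE.
- move=> h' hs' h'X h'Y; apply: star_hom_eq hs' hs pair_generated _.
  move=> _ [[] [x [y ->]]].
    by rewrite -iXE h'X iXE h1 [RHS]mxE.
  by rewrite -iYE h'Y iYE h2 [RHS]mxE.
Qed.

Lemma qperm_pair_quotient (Q : cstarAlgType R) (q : 'M[Q]_n) : [disjoint S & T] ->
  is_CQu G q -> is_quotient Q qperm_pair.
Proof.
move=> ST [_ _ _ uq]; have [qS qT] := pair_genP.
have [mW aW] := glue_magic ST qS qT.
have [f fs fE] := uq _ _ mW aW; exists f; split=> //.
apply: (star_hom_onto fs pair_generated) => _ [[] [x [y ->]]].
  have [xS|xS] := boolP (x \in S); first by exists (q x y); rewrite fE mxE xS.
  have [_ _ /(_ x y)] := qS; rewrite xS => -> //.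
  by exists (x == y)%:R; rewrite rmorph_nat.
have [xT|xT] := boolP (x \in T).
  by exists (q x y); rewrite fE mxE (disjointFl ST xT).
have [_ _ /(_ x y)] := qT; rewrite xT => -> //.
by exists (x == y)%:R; rewrite rmorph_nat.
Qed.

End FreeProduct.
End QuantumPermutations.

(** * Matrix C*-algebras *)

Section HermitianSpace.
Variable R : realType.
Local Notation C := (R[i]).

(** For [x] and [y] the two norms and [s] the inner product, the sum of the squares
    [(y a_j - x b_j)^2] is [2 x y (x y - s)]. The case of a zero norm is apart because [x y] is
    cancelled. *)
Lemma real_cauchy_schwarz (J : finType) (a b : J -> R) :
  (\sum_j a j * b j) <= Num.sqrt (\sum_j a j ^+ 2) * Num.sqrt (\sum_j b j ^+ 2).
Proof.
have sq (c : J -> R) : 0 <= \sum_j c j ^+ 2 by apply: sumr_ge0 => j _; exact: sqr_ge0.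
set x := Num.sqrt _; set y := Num.sqrt _.
have x2 : x ^+ 2 = \sum_j a j ^+ 2 by rewrite sqr_sqrtr.
have y2 : y ^+ 2 = \sum_j b j ^+ 2 by rewrite sqr_sqrtr.
have x0 : 0 <= x by apply: sqrtr_ge0.
have y0 : 0 <= y by apply: sqrtr_ge0.
have zero (c : J -> R) j : \sum_j c j ^+ 2 = 0 -> c j = 0.
  move=> /eqP; rewrite psumr_eq0 => [/allP/(_ j)|i _]; last exact: sqr_ge0.
  by rewrite mem_index_enum sqrf_eq0 => /(_ isT)/eqP.
have [x00|xn0] := eqVneq x 0.
  rewrite x00 mul0r big1 // => j _; rewrite (zero a) ?mul0r //.
  by rewrite -x2 x00 expr0n.
have [y00|yn0] := eqVneq y 0.
  rewrite y00 mulr0 big1 // => j _; rewrite (zero b) ?mulr0 //.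
  by rewrite -y2 y00 expr0n.
have xp : 0 < x by rewrite lt_def xn0.
have yp : 0 < y by rewrite lt_def yn0.
have : 0 <= \sum_j (y * a j - x * b j) ^+ 2 by apply: sq.
have -> : \sum_j (y * a j - x * b j) ^+ 2 =
    y ^+ 2 * (\sum_j a j ^+ 2) - 2 * (x * y) * (\sum_j a j * b j) + x ^+ 2 * (\sum_j b j ^+ 2).
  rewrite !mulr_sumr -sumrN -!big_split /=; apply: eq_bigr => j _; ring.
rewrite -x2 -y2; set s := \sum_j _.
have -> : y ^+ 2 * x ^+ 2 - 2 * (x * y) * s + x ^+ 2 * y ^+ 2 = 2 * (x * y * (x * y - s)) by ring.
by rewrite pmulr_rge0 // pmulr_rge0 ?mulr_gt0 // subr_ge0.
Qed.

Definition vdot n (u v : 'rV[C]_n) : C := \sum_j u 0 j * conjc (v 0 j).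
Definition vnorm n (u : 'rV[C]_n) : R := Num.sqrt (\sum_j normc (u 0 j) ^+ 2).

Lemma normc_conj (c : C) : normc (conjc c) = normc c.
Proof. by case: c => a b /=; rewrite sqrrN. Qed.

Lemma conjc_sum (J : finType) (F : J -> C) : conjc (\sum_j F j) = \sum_j conjc (F j).
Proof. exact: (@star_sum R (R[i]^o) _ _ _ F). Qed.

Lemma conjcD (c d : C) : conjc (c + d) = conjc c + conjc d.
Proof. exact: (@starD R (R[i]^o) c d). Qed.

Lemma conjcM (c d : C) : conjc (c * d) = conjc d * conjc c.
Proof. exact: (@starM R (R[i]^o) c d). Qed.

Lemma normc_sum (J : finType) (F : J -> C) : normc (\sum_j F j) <= \sum_j normc (F j).
Proof.
apply: (big_ind2 (fun x (y : R) => normc x <= y)); rewrite ?normc0 //.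
by move=> x1 y1 x2 y2 h1 h2; apply: le_trans (le_normcD _ _) (lerD h1 h2).
Qed.

Lemma vnorm_ge0 n (u : 'rV[C]_n) : 0 <= vnorm u. Proof. exact: sqrtr_ge0. Qed.

Lemma vnorm_sqr n (u : 'rV[C]_n) : vnorm u ^+ 2 = \sum_j normc (u 0 j) ^+ 2.
Proof. by rewrite sqr_sqrtr // sumr_ge0 // => j _; exact: sqr_ge0. Qed.

Lemma normc_vdot n (u v : 'rV[C]_n) : normc (vdot u v) <= vnorm u * vnorm v.
Proof.
apply: le_trans (normc_sum _) _.
under eq_bigr do rewrite normcM normc_conj.
exact: real_cauchy_schwarz.
Qed.

Lemma mulr_conjc (c : C) : c * conjc c = (normc c ^+ 2)%:C.
Proof.
case: c => a b; rewrite /= sqr_sqrtr ?addr_ge0 ?sqr_ge0 //.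
by apply/eqP; rewrite eq_complex /=; apply/andP; split; apply/eqP; ring.
Qed.

Lemma vdotvv n (u : 'rV[C]_n) : vdot u u = (vnorm u ^+ 2)%:C.
Proof.
by rewrite vnorm_sqr rmorph_sum; apply: eq_bigr => j _; rewrite mulr_conjc.
Qed.

Lemma vnormD n (u v : 'rV[C]_n) : vnorm (u + v) <= vnorm u + vnorm v.
Proof.
rewrite -(ler_pXn2r (n := 2)) ?nnegrE ?addr_ge0 ?vnorm_ge0 // vnorm_sqr.
apply: (@le_trans _ _ (\sum_j (normc (u 0 j) + normc (v 0 j)) ^+ 2)).
  by apply: ler_sum => j _; rewrite mxE lerXn2r ?nnegrE ?addr_ge0 ?normc_ge0 // le_normcD.
under eq_bigr do rewrite sqrrD; rewrite !big_split /= -!vnorm_sqr sqrrD lerD2r lerD2l.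
by rewrite -mulr2n lerMn2r real_cauchy_schwarz.
Qed.

Lemma vnormZ n (c : C) (u : 'rV[C]_n) : vnorm (c *: u) = normc c * vnorm u.
Proof.
rewrite /vnorm; under eq_bigr do rewrite mxE normcM exprMn.
by rewrite -mulr_sumr sqrtrM ?sqr_ge0 // sqrtr_sqr ger0_norm ?normc_ge0.
Qed.

Lemma vnorm0 n : vnorm (0 : 'rV[C]_n) = 0.
Proof. by rewrite -(scale0r (0 : 'rV[C]_n)) vnormZ normc0 mul0r. Qed.

Lemma normc_le_vnorm n (u : 'rV[C]_n) j : normc (u 0 j) <= vnorm u.
Proof.
rewrite -(ler_pXn2r (n := 2)) ?nnegrE ?vnorm_ge0 ?normc_ge0 // vnorm_sqr.
by rewrite (bigD1 j) //= lerDl sumr_ge0 // => i _; exact: sqr_ge0.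
Qed.

Lemma vnorm_le_sum n (u : 'rV[C]_n) : vnorm u <= \sum_j normc (u 0 j).
Proof.
have s0 : 0 <= \sum_j normc (u 0 j) by apply: sumr_ge0 => j _; exact: normc_ge0.
rewrite -(ler_pXn2r (n := 2)) ?nnegrE ?vnorm_ge0 // vnorm_sqr expr2 mulr_suml.
apply: ler_sum => j _; rewrite expr2 ler_wpM2l ?normc_ge0 //.
by rewrite (bigD1 j) //= lerDl sumr_ge0 // => i _; exact: normc_ge0.
Qed.

Lemma vnorm_eq0 n (u : 'rV[C]_n) : vnorm u = 0 -> u = 0.
Proof.
move=> u0; apply/rowP => j; rewrite mxE; apply: eq0_normc; apply/eqP.
by rewrite eq_le normc_ge0 andbT -u0 normc_le_vnorm.
Qed.

End HermitianSpace.

(** * The operator norm of complex matrices *)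

Section MatrixAlgebra.
Variables (R : realType) (m : nat).
Local Notation C := (R[i]).

Definition cmat := 'M[R[i]]_m.+1.
HB.instance Definition _ := GRing.Algebra.on cmat.

Implicit Types (A B : cmat) (u v : 'rV[C]_m.+1).

Definition adjmx A : cmat := \matrix_(i, j) conjc (A j i).

Definition opnorm A : R :=
  sup [set a | exists2 v, vnorm v <= 1 & a = vnorm (v *m A)]%classic.

(** An explicit bound for the operator norm; together with [opnorm_entry] it reduces completeness to
    that of the complex numbers, entry by entry. *)
Definition sumnorm A : R := \sum_i \sum_j normc (A i j).

Lemma sumnorm_bound v A : vnorm v <= 1 -> vnorm (v *m A) <= sumnorm A.
Proof.
move=> v1; apply: le_trans (vnorm_le_sum _) _; rewrite /sumnorm exchange_big /=.
apply: ler_sum => j _; rewrite mxE; apply: le_trans (normc_sum _) _.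
apply: ler_sum => i _; rewrite normcM ler_piMl ?normc_ge0 //.
exact: le_trans (normc_le_vnorm _ _) v1.
Qed.

Lemma opnorm_ub v A : vnorm v <= 1 -> vnorm (v *m A) <= opnorm A.
Proof.
move=> v1; apply: ub_le_sup; last by exists v.
by exists (sumnorm A) => _ [w w1 ->]; exact: sumnorm_bound.
Qed.

Lemma opnorm_le A (K : R) : (forall v, vnorm v <= 1 -> vnorm (v *m A) <= K) -> opnorm A <= K.
Proof.
move=> h; apply: ge_sup; last by move=> _ [v v1 ->]; exact: h.
by exists (vnorm ((0 : 'rV[C]_m.+1) *m A)), 0; rewrite ?vnorm0.
Qed.

Lemma opnorm_ge0 A : 0 <= opnorm A.
Proof. by have := @opnorm_ub 0 A; rewrite vnorm0 mul0mx vnorm0; apply. Qed.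

Lemma opnormP v A : vnorm (v *m A) <= opnorm A * vnorm v.
Proof.
have [v0|v0] := eqVneq (vnorm v) 0.
  by rewrite (vnorm_eq0 v0) mul0mx vnorm0 mulr0.
have vp : 0 < vnorm v by rewrite lt_def v0 vnorm_ge0.
have := @opnorm_ub ((vnorm v)^-1%:C *: v) A.
rewrite -scalemxAl !vnormZ normc_real ger0_norm ?invr_ge0 ?vnorm_ge0 //.
by rewrite mulVf // => /(_ (lexx _)); rewrite mulrC ler_pdivrMr.
Qed.

Lemma opnorm_entry A i j : normc (A i j) <= opnorm A.
Proof.
have e1 : vnorm (delta_mx 0 i : 'rV[C]_m.+1) <= 1.
  rewrite /vnorm (bigD1 i) //= big1 => [|k ki]; last by rewrite mxE (negPf ki) andbF normc0 expr0n.
  by rewrite mxE !eqxx normc1 expr1n addr0 sqrtr1.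
by apply: le_trans (opnorm_ub A e1); rewrite -rowE; have := normc_le_vnorm (row i A) j; rewrite mxE.
Qed.

Lemma opnorm_le_sum A : opnorm A <= sumnorm A.
Proof. by apply: opnorm_le => v; exact: sumnorm_bound. Qed.

Lemma opnorm0_eq0 A : opnorm A = 0 -> A = 0.
Proof.
move=> A0; apply/matrixP => i j; rewrite mxE; apply: eq0_normc; apply/eqP.
by rewrite eq_le normc_ge0 andbT -A0 opnorm_entry.
Qed.

Lemma opnormD A B : opnorm (A + B) <= opnorm A + opnorm B.
Proof.
apply: opnorm_le => v v1; rewrite mulmxDr; apply: le_trans (vnormD _ _) _.
by rewrite lerD ?opnorm_ub.
Qed.

Lemma opnormZ_le (c : C) A : opnorm (c *: A) <= normc c * opnorm A.
Proof.
by apply: opnorm_le => v v1; rewrite -scalemxAr vnormZ ler_wpM2l ?normc_ge0 ?opnorm_ub.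
Qed.

Lemma opnormZ (c : C) A : opnorm (c *: A) = normc c * opnorm A.
Proof.
apply/eqP; rewrite eq_le opnormZ_le /=.
have [->|c0] := eqVneq c 0; first by rewrite normc0 mul0r opnorm_ge0.
have nc : 0 < normc c by rewrite lt_def normc_ge0 andbT; apply: contra c0 => /eqP/eq0_normc ->.
rewrite mulrC -ler_pdivlMr // mulrC; have := opnormZ_le c^-1 (c *: A).
by rewrite scalerA mulVf // scale1r normcV.
Qed.

Lemma opnormM A B : opnorm (A * B) <= opnorm A * opnorm B.
Proof.
apply: opnorm_le => v v1; rewrite mulmxA mulrC; apply: le_trans (opnormP _ _) _.
by rewrite ler_wpM2l ?opnorm_ge0 ?opnorm_ub.
Qed.

Lemma vdot_adj u v A : vdot (u *m A) v = vdot u (v *m adjmx A).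
Proof.
rewrite /vdot; under eq_bigr do rewrite mxE mulr_suml; rewrite exchange_big /=.
apply: eq_bigr => i _; rewrite mxE conjc_sum mulr_sumr; apply: eq_bigr => j _.
by rewrite conjcM [adjmx A _ _]mxE conjcK mulrA.
Qed.

Lemma adjmxK : involutive adjmx.
Proof. by move=> A; apply/matrixP => i j; rewrite !mxE conjcK. Qed.

(** The square of the norm of [v *m A] is the inner product of [v] with [v *m (A * adjmx A)], to
    which Cauchy-Schwarz applies. *)
Lemma opnorm_sqr_le A : opnorm A ^+ 2 <= opnorm (A * adjmx A).
Proof.
rewrite -[leRHS]sqr_sqrtr ?opnorm_ge0 // lerXn2r ?nnegrE ?opnorm_ge0 ?sqrtr_ge0 //.
apply: opnorm_le => v v1.
rewrite -[leLHS]ger0_norm ?vnorm_ge0 // -sqrtr_sqr ler_wsqrtr //.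
have E : vdot (v *m A) (v *m A) = vdot v (v *m (A * adjmx A)) by rewrite vdot_adj mulmxA.
have -> : vnorm (v *m A) ^+ 2 = normc (vdot v (v *m (A * adjmx A))).
  by rewrite -E vdotvv normc_real ger0_norm // sqr_ge0.
apply: le_trans (normc_vdot _ _) _; rewrite -[leRHS]mul1r.
by rewrite ler_pM ?vnorm_ge0 ?opnorm_ub.
Qed.

Lemma opnorm_adj A : opnorm (adjmx A) = opnorm A.
Proof.
have le B : opnorm B <= opnorm (adjmx B).
  have [->|B0] := eqVneq (opnorm B) 0; first exact: opnorm_ge0.
  have Bp : 0 < opnorm B by rewrite lt_def B0 opnorm_ge0.
  rewrite -(ler_pM2l Bp) -expr2; apply: le_trans (opnorm_sqr_le B) (opnormM _ _).
by apply/eqP; rewrite eq_le le andbT -{2}(adjmxK A) le.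
Qed.

Lemma opnorm_adjM A : opnorm (adjmx A * A) = opnorm A ^+ 2.
Proof.
apply/eqP; rewrite eq_le; apply/andP; split.
  by apply: le_trans (opnormM _ _) _; rewrite opnorm_adj expr2.
by have := opnorm_sqr_le (adjmx A); rewrite opnorm_adj adjmxK.
Qed.

Lemma cmat_complete (w : nat -> cmat) :
  (forall eps : R, 0 < eps -> exists N : nat, forall k l : nat,
     (N <= k)%N -> (N <= l)%N -> opnorm (w k - w l) < eps) ->
  exists l : cmat, forall eps : R, 0 < eps -> exists N : nat, forall k : nat,
     (N <= k)%N -> opnorm (w k - l) < eps.
Proof.
move=> wC.
have lim ij : exists l : C, forall eps : R, 0 < eps -> exists N : nat, forall k : nat,
     (N <= k)%N -> normc (w k ij.1 ij.2 - l) < eps.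
  apply: complex_complete => e /wC[N HN]; exists N => k l Nk Nl.
  apply: le_lt_trans (HN k l Nk Nl); have := opnorm_entry (w k - w l) ij.1 ij.2.
  by rewrite !mxE.
have [l lP] := choice lim.
exists (\matrix_(i, j) l (i, j)) => e e0; pose K : R := (m.+1 * m.+1)%:R.
have K0 : 0 < K by rewrite ltr0n.
have [N NP] := choice (fun ij => lP ij (e / K) ltac:(by rewrite divr_gt0)).
exists (\max_ij N ij) => k Nk; apply: le_lt_trans (opnorm_le_sum _) _.
have -> : e = \sum_(i < m.+1) \sum_(j < m.+1) (e / K).
  rewrite !sumr_const !card_ord -mulrnA -mulr_natr -/K.
  by rewrite divfK // lt0r_neq0.
rewrite /sumnorm !pair_big /=.
apply: ltr_sum => [|[i j] _]; first by apply/hasP; exists (ord0, ord0); rewrite ?mem_index_enum.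
rewrite !mxE; apply: (NP (i, j)); apply: leq_trans Nk.
exact: (leq_bigmax (i, j)).
Qed.

Lemma adjmxD : {morph adjmx : A B / A + B}.
Proof. by move=> A B; apply/matrixP => i j; rewrite !mxE conjcD. Qed.
Lemma adjmxZ (c : C) A : adjmx (c *: A) = conjc c *: adjmx A.
Proof. by apply/matrixP => i j; rewrite !mxE conjcM mulrC. Qed.
Lemma adjmxM A B : adjmx (A * B) = adjmx B * adjmx A.
Proof.
apply/matrixP => i j; rewrite !mxE conjc_sum; apply: eq_bigr => k _.
by rewrite !mxE conjcM.
Qed.

HB.instance Definition _ := isUnitalCStarAlgebra.Build R cmat
  adjmxK adjmxD adjmxZ adjmxM opnorm0_eq0 opnormD opnormZ opnormM opnorm_adjM cmat_complete.

End MatrixAlgebra.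

(** * Finite-dimensional *-subalgebras *)

Section RealSpectrum.
Variables (R : realType) (d : nat).
Local Notation C := (R[i]).

(** Meant for left multiplications in an arbitrary basis, which need not be Hermitian; hence Schur
    triangularization. The traces of [A] and of its square are sums over the real diagonal of [T];
    if the squares sum to 0, that diagonal vanishes and Cayley-Hamilton makes [T] nilpotent. *)
Lemma real_spectrum_trace (A : 'M[C]_d.+1) :
  (forall a, eigenvalue A a -> conjc a = a) ->
  conjc (\tr A) = \tr A /\
  exists r : R, [/\ 0 <= r, \tr (A *m A) = r%:C & r = 0 -> exists k, A ^+ k = 0].
Proof.
move=> real; have [P Pu /=] := Schur A (ltn0Sn d).
have Pn := unitarymx_unit Pu; rewrite /similar_to conjumx // => trig.
have [T Ttrig AE] : exists2 T, is_trig_mx T & A = invmx P *m T *m P.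
  by exists (P *m A *m invmx P); rewrite ?mulmxA ?mulVmx ?mul1mx ?mulmxKV.
have T0 (i j : 'I_d.+1) : (i < j)%N -> T i j = 0 by exact/is_trig_mxP.
have Treal i : conjc (T i i) = T i i.
  apply: real; have : eigenvalue T (T i i).
    rewrite eigenvalue_root_char char_poly_trig //.
    rewrite -(big_map (fun j => T j j) predT (fun a => 'X - a%:P)) root_prod_XsubC.
    by apply/mapP; exists i; rewrite ?mem_index_enum.
  move=> /eigenvalueP[v vT v0]; apply/eigenvalueP; exists (v *m P).
    by rewrite AE !mulmxA mulmxK // vT scalemxAl.
  by apply: contra v0 => /eqP vP; rewrite -(mulmxK Pn v) vP mul0mx.
have trE B : \tr (invmx P *m B *m P) = \tr B by rewrite mxtrace_mulC mulmxA mulmxV // mul1mx.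
have Tre i : T i i = (complex.Re (T i i))%:C.
  have := Treal i; case: (T i i) => x y /= [] yN; congr (_ +i* _).
  by move: yN; lra.
split.
  rewrite AE trE /mxtrace conjc_sum; apply: eq_bigr => i _; exact: Treal.
exists (\sum_i (complex.Re (T i i)) ^+ 2); split.
- by apply: sumr_ge0 => i _; exact: sqr_ge0.
- have -> : A *m A = invmx P *m (T *m T) *m P by rewrite AE !mulmxA mulmxK.
  rewrite trE /mxtrace rmorph_sum; apply: eq_bigr => i _.
  rewrite mxE (bigD1 i) //= big1 ?addr0 => [|j ji]; first by rewrite rmorphXn /= -Tre expr2.
  case: (ltngtP i j) => [ij|ij|/val_inj E]; first by rewrite (T0 i j) // mul0r.
    by rewrite (T0 j i) // mulr0.
  by rewrite E eqxx in ji.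
- move/eqP; rewrite psumr_eq0 => [/allP h|i _]; last exact: sqr_ge0.
  have Tii i : T i i = 0.
    have := h i; rewrite mem_index_enum sqrf_eq0 => /(_ isT)/eqP E.
    by rewrite Tre E.
  have := Cayley_Hamilton T; rewrite char_poly_trig //.
  under eq_bigr do rewrite Tii subr0; rewrite prodr_const card_ord rmorphXn /= horner_mx_X => Tn.
  exists d.+1; have pow k : A ^+ k = invmx P *m (T ^+ k) *m P.
    elim: k => [|k IH]; first by rewrite !expr0 mulmx1 mulVmx.
    by rewrite !exprS -!mulmxE IH {1}AE !mulmxA mulmxK.
  by rewrite pow Tn mulmx0 mul0mx.
Qed.

End RealSpectrum.

(** * Left regular representation and trace form of a finite-dimensional *-subalgebra *)

Section FiniteSubalgebras.
Variables (R : realType) (X : cstarAlgType R).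
Local Notation C := (R[i]).

Definition lincomb d (b : 'I_d -> X) (v : 'rV[C]_d) : X := \sum_i v 0 i *: b i.
Definition in_span d (b : 'I_d -> X) x := exists v, x = lincomb b v.

Definition spans_subalgebra d (b : 'I_d -> X) :=
  [/\ in_span b 1, forall x y, in_span b x -> in_span b y -> in_span b (x * y) &
      forall x, in_span b x -> in_span b (star x)].

Lemma lincombD d (b : 'I_d -> X) v w : lincomb b (v + w) = lincomb b v + lincomb b w.
Proof. by rewrite /lincomb -big_split; apply: eq_bigr => i _; rewrite mxE scalerDl. Qed.

Lemma lincombZ d (b : 'I_d -> X) (c : C) v : lincomb b (c *: v) = c *: lincomb b v.
Proof. by rewrite /lincomb scaler_sumr; apply: eq_bigr => i _; rewrite mxE scalerA. Qed.

Lemma lincombB d (b : 'I_d -> X) v w : lincomb b (v - w) = lincomb b v - lincomb b w.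
Proof. by rewrite -scaleN1r lincombD lincombZ scaleN1r. Qed.

Lemma lincomb0 d (b : 'I_d -> X) : lincomb b 0 = 0.
Proof. by rewrite -(scale0r (0 : 'rV[C]_d)) lincombZ scale0r. Qed.

Lemma lincomb_sum d (b : 'I_d -> X) (J : finType) (F : J -> 'rV[C]_d) :
  lincomb b (\sum_j F j) = \sum_j lincomb b (F j).
Proof. exact: (big_morph _ (lincombD b) (lincomb0 b)). Qed.

Lemma lincomb_delta d (b : 'I_d -> X) i : lincomb b (delta_mx 0 i) = b i.
Proof.
rewrite /lincomb (bigD1 i) //= big1 ?addr0 => [|j ji]; first by rewrite mxE !eqxx scale1r.
by rewrite mxE (negPf ji) andbF scale0r.
Qed.

Lemma free_spanning d (b : 'I_d -> X) : exists k (e : 'I_k -> X),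
  (forall v, lincomb e v = 0 -> v = 0) /\ (forall x, in_span e x <-> in_span b x).
Proof.
elim: d b => [|d IH] b.
  by exists 0, b; split=> // v _; apply/rowP => -[].
have [fr|] := pselect (forall v, lincomb b v = 0 -> v = 0); first by exists d.+1, b.
move=> /existsNP[v /not_implyP[vb v0]].
have [j vj] : exists j, v 0 j != 0.
  apply/not_existsP => h; apply: v0.
  by apply/rowP => j; rewrite mxE; apply/eqP/negPn/negP/h.
have [k [e [fr eb]]] := IH (b \o lift j); exists k, e; split=> // x; rewrite eb.
split=> [] [w ->].
  exists (\row_i if unlift j i is Some i' then w 0 i' else 0).
  rewrite /lincomb (bigD1_ord j) //= mxE unlift_none scale0r add0r.
  by apply: eq_bigr => i _; rewrite mxE liftK.
pose u := w - (w 0 j / v 0 j) *: v.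
have -> : lincomb b w = lincomb b u.
  by rewrite /u -scaleN1r lincombD !lincombZ vb !scaler0 addr0.
exists (\row_i u 0 (lift j i)).
rewrite /lincomb (bigD1_ord j) //= (_ : u 0 j = 0) ?scale0r ?add0r.
  by apply: eq_bigr => i _; rewrite mxE.
by rewrite /u !mxE divfK // subrr.
Qed.

Section LeftRegular.
Variables (d : nat) (b : 'I_d.+1 -> X).
Hypothesis free : forall v, lincomb b v = 0 -> v = 0.
Hypothesis sub : spans_subalgebra b.
Local Notation S := (in_span b).

Let S1 : S 1. Proof. by case: sub. Qed.
Let SM x y : S x -> S y -> S (x * y). Proof. by case: sub => _ + _; apply. Qed.
Let Sst x : S x -> S (star x). Proof. by case: sub => _ _; apply. Qed.
Let Sb i : S (b i). Proof. by exists (delta_mx 0 i); rewrite lincomb_delta. Qed.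
Let SD x y : S x -> S y -> S (x + y).
Proof. by move=> [v ->] [w ->]; exists (v + w); rewrite lincombD. Qed.
Let SZ (c : C) x : S x -> S (c *: x).
Proof. by move=> [v ->]; exists (c *: v); rewrite lincombZ. Qed.
Let SN x : S x -> S (- x). Proof. by rewrite -scaleN1r; exact: SZ. Qed.
Let Ssum (J : finType) (F : J -> X) : (forall j, S (F j)) -> S (\sum_j F j).
Proof. by move=> h; apply: big_ind => //; exists 0; rewrite lincomb0. Qed.

Lemma lincomb_inj v w : lincomb b v = lincomb b w -> v = w.
Proof.
move=> E; apply/eqP; rewrite -subr_eq0; apply/eqP/free.
by rewrite lincombB E subrr.
Qed.

Definition coords x : 'rV[C]_d.+1 :=
  if pselect (S x) is left h then projT1 (cid h) else 0.

Lemma lincomb_coords x : S x -> lincomb b (coords x) = x.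
Proof. by move=> Sx; rewrite /coords; case: pselect => // h; case: cid. Qed.

(** Matrices act on row vectors from the right, so [lmul] reverses products; traces are not
    affected. *)
Definition lmul x : 'M[C]_d.+1 := \matrix_i coords (x * b i).

Lemma lmulP x v : S x -> lincomb b (v *m lmul x) = x * lincomb b v.
Proof.
move=> Sx; rewrite mulmx_sum_row lincomb_sum /lincomb mulr_sumr; apply: eq_bigr => i _.
by rewrite -/(lincomb b _) lincombZ rowK lincomb_coords ?scalerAr //; apply: SM.
Qed.

Lemma lmul_uniq x M : S x -> (forall v, lincomb b (v *m M) = x * lincomb b v) -> lmul x = M.
Proof.
move=> Sx h; apply/row_matrixP => i; rewrite !rowE; apply: lincomb_inj.
by rewrite h lmulP.
Qed.

Lemma lmulM x y : S x -> S y -> lmul (x * y) = lmul y *m lmul x.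
Proof.
by move=> Sx Sy; apply: lmul_uniq => [|v]; [exact: SM|rewrite mulmxA !lmulP // mulrA].
Qed.

Lemma lmulD x y : S x -> S y -> lmul (x + y) = lmul x + lmul y.
Proof.
move=> Sx Sy; apply: lmul_uniq => [|v]; first exact: SD.
by rewrite mulmxDr lincombD !lmulP // mulrDl.
Qed.

Lemma lmulZ (c : C) x : S x -> lmul (c *: x) = c *: lmul x.
Proof.
move=> Sx; apply: lmul_uniq => [|v]; first exact: SZ.
by rewrite -scalemxAr lincombZ lmulP // scalerAl.
Qed.

Lemma lmul1 : lmul 1 = 1.
Proof. by apply: lmul_uniq => // v; rewrite mulmx1 mul1r. Qed.

Lemma lmul_eq0 x : S x -> lmul x = 0 -> x = 0.
Proof.
move=> Sx x0; have := lmulP (coords 1) Sx.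
by rewrite x0 mulmx0 lincomb0 lincomb_coords // mulr1 => <-.
Qed.

Lemma lmulX x k : S x -> lmul (x ^+ k) = lmul x ^+ k.
Proof.
move=> Sx; have Sk j : S (x ^+ j) by elim: j => [|j IH]; rewrite ?expr0 // exprS; apply: SM.
elim: k => [|k IH]; first by rewrite !expr0 lmul1.
by rewrite exprS lmulM // IH exprSr.
Qed.

(** For an eigenvector [y], the element [star y * x * y = a *: (star y * y)] is self-adjoint, and
    [star y * y] is nonzero by the C*-identity. *)
Lemma selfadjoint_real_spectrum x : S x -> star x = x ->
  forall a, eigenvalue (lmul x) a -> conjc a = a.
Proof.
move=> Sx sx a /eigenvalueP[v vx v0]; pose y := lincomb b v.
have xy : x * y = a *: y by rewrite -lmulP // vx lincombZ.
have y0 : star y * y != 0.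
  apply/eqP => /starM_eq0 y0; case/eqP: v0; exact: free.
have E : star y * (x * y) = a *: (star y * y) by rewrite xy scalerAr.
have := congr1 star E; rewrite starZ starM starM sx starM starK -mulrA E => /esym/eqP.
rewrite -subr_eq0 -scalerBl => /eqP h.
apply/eqP; rewrite -subr_eq0; apply/negPn/negP => n0.
case/negP: y0; rewrite -(scale1r (star y * y)) -(mulVf n0) -scalerA.
by rewrite [X in _ *: X]h scaler0.
Qed.

Definition trace_form x : C := \tr (lmul x).
Local Notation phi := trace_form.

Lemma trace_formD x y : S x -> S y -> phi (x + y) = phi x + phi y.
Proof. by move=> Sx Sy; rewrite /phi lmulD // mxtraceD. Qed.

Lemma trace_formZ (c : C) x : S x -> phi (c *: x) = c * phi x.
Proof. by move=> Sx; rewrite /phi lmulZ // mxtraceZ. Qed.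

Lemma trace_form_sum (J : finType) (c : J -> C) (F : J -> X) : (forall j, S (F j)) ->
  phi (\sum_j c j *: F j) = \sum_j c j * phi (F j).
Proof.
move=> SF; pose K x y := S x /\ phi x = y.
suff : K (\sum_j c j *: F j) (\sum_j c j * phi (F j)) by case.
apply: (big_ind2 K) => [|x y z w [Sx <-] [Sz <-]|j _].
- split; first by exists 0; rewrite lincomb0.
  by rewrite -(scale0r (1 : X)) trace_formZ // mul0r.
- by split; [exact: SD|exact: trace_formD].
- by split; [exact: SZ|exact: trace_formZ].
Qed.

Lemma re_part_span x : S x -> S (re_part x).
Proof. by move=> Sx; apply: SZ; apply: SD => //; apply: Sst. Qed.

Lemma im_part_span x : S x -> S (im_part x).
Proof. by move=> Sx; apply: SZ; apply: SN; apply: SZ; apply: SD => //; apply: SN; apply: Sst. Qed.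

Lemma trace_form_star x : S x -> phi (star x) = conjc (phi x).
Proof.
move=> Sx; have Sr := re_part_span Sx; have Si := im_part_span Sx.
have [rR _] := real_spectrum_trace (selfadjoint_real_spectrum Sr (re_part_selfadjoint x)).
have [iR _] := real_spectrum_trace (selfadjoint_real_spectrum Si (im_part_selfadjoint x)).
rewrite {1 2}(re_im_part x) starD starZi re_part_selfadjoint im_part_selfadjoint -scaleNr.
rewrite !trace_formD; try exact: SZ; try by [].
rewrite !(trace_formZ _ Si) conjcD conjcM /trace_form rR iR mulrC; congr (_ + _ * _).
by apply/eqP; rewrite eq_complex /= oppr0 !eqxx.
Qed.

(* As [phi] is a trace, [phi (star x * x) = phi (a * a) + phi (b * b)] for the
   real and imaginary parts of [x], and these have real spectrum. *)
Lemma trace_form_pos x : S x ->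
  exists r : R, [/\ 0 <= r, phi (star x * x) = r%:C & r = 0 -> x = 0].
Proof.
move=> Sx; have Sr := re_part_span Sx; have Si := im_part_span Sx.
have sr := re_part_selfadjoint x; have si := im_part_selfadjoint x.
have [_ [r [r0 rE rz]]] := real_spectrum_trace (selfadjoint_real_spectrum Sr sr).
have [_ [s [s0 sE sz]]] := real_spectrum_trace (selfadjoint_real_spectrum Si si).
(* Faithfulness of [lmul] carries nilpotency of the matrix back to [y], and a self-adjoint nilpotent
   is zero. *)
have nil y k : S y -> star y = y -> lmul y ^+ k = 0 -> y = 0.
  move=> Sy sy; rewrite -lmulX // => /lmul_eq0 yk; apply: (selfadjoint_nilpotent (k := k)) => //.
  apply: yk; elim: (k) => [|j IH]; rewrite ?expr0 // exprS; exact: SM.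
exists (r + s); split; first exact: addr_ge0.
- rewrite /trace_form lmulM //; last exact: Sst.
  have -> : lmul (star x) = lmul (re_part x) - 'i *: lmul (im_part x).
    rewrite {1}(re_im_part x) starD starZi sr si -scaleNr lmulD //; last exact: SZ.
    by rewrite (lmulZ _ Si) scaleNr.
  rewrite {1}(re_im_part x) lmulD //; last exact: SZ.
  rewrite (lmulZ _ Si) mulmxBr !mulmxDl -!scalemxAl -!scalemxAr scalerA mulii scaleN1r.
  have trN (M : 'M[C]_d.+1) : \tr (- M) = - \tr M by exact: raddfN.
  rewrite !(mxtraceD, trN, mxtraceZ) rE sE (mxtrace_mulC (lmul (im_part x))) rmorphD /=; ring.
- move=> /eqP; rewrite paddr_eq0 // => /andP[/eqP/rz[k rk] /eqP/sz[l sl]].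
  by rewrite (re_im_part x) (nil _ _ Sr sr rk) (nil _ _ Si si sl) scaler0 addr0.
Qed.

(** The inner product is [phi (star x * y)]. The number [m] counts the basis vectors already
    treated, and [y] is the part of the next one orthogonal to the previous [e j]. *)
Lemma gram_schmidt m : (m <= d.+1)%N -> exists k (e : 'I_k -> X),
  [/\ forall i, S (e i), forall i j, phi (star (e i) * e j) = (i == j)%:R &
      forall i : 'I_d.+1, (i < m)%N -> b i = \sum_j phi (star (e j) * b i) *: e j].
Proof.
elim: m => [|m IH] md.
  by exists 0, (fun _ => 0); split=> [[]|[]|].
have [k [e [Se eo eb]]] := IH (ltnW md); pose im := Ordinal md.
pose y := b im - \sum_j phi (star (e j) * b im) *: e j.
have Sc (c : 'I_k -> C) : S (\sum_j c j *: e j) by apply: Ssum => j; apply: SZ.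
have Sy : S y by apply: SD => //; apply: SN.
have phie (c : 'I_k -> C) i : phi (star (e i) * \sum_j c j *: e j) = c i.
  rewrite mulr_sumr; under eq_bigr do rewrite -scalerAr.
  rewrite trace_form_sum => [|j]; last by apply: SM => //; apply: Sst.
  rewrite (bigD1 i) //= big1 ?addr0 => [|j ji]; first by rewrite eo eqxx mulr1.
  by rewrite eo eq_sym (negPf ji) mulr0.
have ey i : phi (star (e i) * y) = 0.
  rewrite /y mulrBr -scaleN1r trace_formD ?trace_formZ ?phie ?mulN1r ?subrr //.
  - by apply: SM => //; apply: Sst.
  - by apply: SM => //; apply: Sst.
  - by apply: SZ; apply: SM => //; apply: Sst.
have [y0|yn0] := eqVneq y 0.
  exists k, e; split=> // i; rewrite ltnS leq_eqVlt => /orP[/eqP im'|/eb //].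
  have -> : i = im by apply: val_inj.
  by apply/eqP; rewrite -subr_eq0 -/y y0.
have [r [r0 rE rz]] := trace_form_pos Sy.
have rp : 0 < r by rewrite lt_def r0 andbT; apply/eqP => /rz /eqP; rewrite (negPf yn0).
pose s := (Num.sqrt r)^-1; have s2 : s * s * r = 1.
  by rewrite /s -invfM -expr2 sqr_sqrtr // mulVf // lt0r_neq0.
pose f := s%:C *: y; have Sf : S f by apply: SZ.
have ff : phi (star f * f) = 1.
  rewrite /f starZr -scalerAl -scalerAr scalerA trace_formZ; last by apply: SM => //; apply: Sst.
  by rewrite rE -!rmorphM s2.
have ef i : phi (star (e i) * f) = 0.
  rewrite /f -scalerAr trace_formZ ?ey ?mulr0 //; by apply: SM => //; apply: Sst.
have fe i : phi (star f * e i) = 0.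
  rewrite -[star f * e i]starK trace_form_star starM starK ?ef ?conjc0 //.
  by apply: SM => //; apply: Sst.
have fc (c : 'I_k -> C) : phi (star f * \sum_j c j *: e j) = 0.
  rewrite mulr_sumr; under eq_bigr do rewrite -scalerAr.
  rewrite trace_form_sum => [|j]; last by apply: SM => //; apply: Sst.
  by rewrite big1 // => j _; rewrite fe mulr0.
exists k.+1, (fun i => if unlift ord0 i is Some j then e j else f); split.
- by move=> i; case: unliftP.
- move=> i j; case: unliftP => [i'|] ->; case: unliftP => [j'|] ->.
  + by rewrite eo (inj_eq (lift_inj (h := ord0))).
  + by rewrite ef eq_sym (negPf (neq_lift _ _)).
  + by rewrite fe (negPf (neq_lift _ _)).
  + by rewrite ff eqxx.
- move=> i im'; rewrite big_ord_recl unlift_none.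
  under eq_bigr do rewrite liftK.
  move: im'; rewrite ltnS leq_eqVlt => /orP[/eqP im'|/eb {1 2}->]; last by rewrite fc scale0r add0r.
  have -> : i = im by apply: val_inj.
  have bE : b im = y + \sum_j phi (star (e j) * b im) *: e j by rewrite /y subrK.
  rewrite {2}bE mulrDr trace_formD ?fc ?addr0; last 2 first.
  + by apply: SM => //; apply: Sst.
  + by apply: SM => //; apply: Sst.
  have -> : phi (star f * y) *: f = y; last by [].
  rewrite /f starZr -scalerAl trace_formZ; last by apply: SM => //; apply: Sst.
  by rewrite rE -rmorphM scalerA -rmorphM mulrAC s2 rmorph1 scale1r.
Qed.

(** The GNS representation of the trace form: left multiplication written in an orthonormal basis,
    so that [star] becomes the conjugate transpose. It is faithful because 1 is a combination of the
    [e j]. The map [rho] is total, but its properties hold only on the span. *)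
Lemma matrix_representation : exists k (rho : X -> cmat R k),
  [/\ forall x y, S x -> S y -> rho (x + y) = rho x + rho y,
      forall x y, S x -> S y -> rho (x * y) = rho x * rho y,
      forall x, S x -> rho (star x) = star (rho x),
      rho 1 = 1 & forall x, S x -> rho x = 0 -> x = 0].
Proof.
have [k [e [Se eo eb]]] := gram_schmidt (leqnn d.+1).
have SeM i x : S x -> S (star (e i) * x) by move=> Sx; apply: SM => //; apply: Sst.
have expand x : S x -> x = \sum_j phi (star (e j) * x) *: e j.
  move=> [v ->]; rewrite {1}/lincomb; under eq_bigr => i _ do rewrite (eb i (ltn_ord i)) scaler_sumr.
  rewrite exchange_big /=; apply: eq_bigr => j _; rewrite /lincomb mulr_sumr.
  under [X in phi X]eq_bigr do rewrite -scalerAr.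
  rewrite trace_form_sum => [|i]; last by apply: SeM.
  by rewrite scaler_suml; apply: eq_bigr => i _; rewrite scalerA.
(* An empty basis would give [1 = 0]; a positive size is what [cmat] expects. *)
case: k e Se eo eb SeM expand => [|k] e Se eo eb SeM expand.
  by have := expand 1 S1; rewrite big_ord0 => /eqP; rewrite oner_eq0.
exists k, (fun x => \matrix_(i, j) phi (star (e i) * (x * e j))).
have Sxe x j : S x -> S (x * e j) by move=> Sx; exact: SM.
split=> [x y Sx Sy|x y Sx Sy|x Sx||x Sx].
- by apply/matrixP => i j; rewrite !mxE mulrDl mulrDr trace_formD //; apply: SeM; apply: Sxe.
- apply/matrixP => i j; rewrite !mxE -mulrA.
  rewrite [y * e j]expand; last exact: Sxe.
  rewrite !mulr_sumr; under [X in phi X]eq_bigr do rewrite -!scalerAr.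
  rewrite trace_form_sum => [|l]; last by rewrite mulrA; apply: SM => //; apply: SeM.
  by apply: eq_bigr => l _; rewrite !mxE mulrC.
- apply/matrixP => i j; rewrite !mxE -trace_form_star ?starM ?starK ?mulrA //.
  by rewrite -mulrA; apply: SeM; apply: Sxe.
- by apply/matrixP => i j; rewrite !mxE mul1r eo.
- move=> /matrixP x0; have xe j : x * e j = 0.
    rewrite [x * e j]expand; last exact: Sxe.
    by rewrite big1 // => i _; have := x0 i j; rewrite !mxE => ->; rewrite scale0r.
  rewrite -[x]mulr1 (expand 1 S1) mulr_sumr big1 // => j _.
  by rewrite -scalerAr xe scaler0.
Qed.

End LeftRegular.

Lemma subalgebra_representation d (b : 'I_d -> X) : spans_subalgebra b ->
  exists k (rho : X -> cmat R k),
  [/\ forall x y, in_span b x -> in_span b y -> rho (x + y) = rho x + rho y,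
      forall x y, in_span b x -> in_span b y -> rho (x * y) = rho x * rho y,
      forall x, in_span b x -> rho (star x) = star (rho x),
      rho 1 = 1 & forall x, in_span b x -> rho x = 0 -> x = 0].
Proof.
case=> b1 bM bS; have [k [e [fr eb]]] := free_spanning b.
case: k e fr eb => [|k] e fr eb.
  have [v /eqP] := (eb 1).2 b1; by rewrite /lincomb big_ord0 oner_eq0.
have sub : spans_subalgebra e.
  split; first exact/eb.
    by move=> x y /eb hx /eb hy; apply/eb; exact: bM.
  by move=> x /eb hx; apply/eb; exact: bS.
have [l [rho [h1 h2 h3 h4 h5]]] := matrix_representation fr sub.
by exists l, rho; split=> // [x y /eb hx /eb hy|x y /eb hx /eb hy|x /eb hx|x /eb hx];
  [exact: h1|exact: h2|exact: h3|exact: h5].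
Qed.

End FiniteSubalgebras.

(** * Tensor products and pairs of projections *)

Section TensorProduct.
Variables (R : realType) (a b : nat).
Local Notation C := (R[i]).

(** The predecessor compensates for the successor in the size of a [cmat]. *)
Definition tens_size := (a.+1 * b.+1 * 2).-1.

Definition tens3 (A : cmat R a) (B : cmat R b) (D : cmat R 1) : cmat R tens_size :=
  (A *t B *t D : 'M[C]_(a.+1 * b.+1 * 2)).

Definition tens_index (i : 'I_a.+1) (j : 'I_b.+1) (k : 'I_2) : 'I_tens_size.+1 :=
  mxtens_index (mxtens_index (i, j), k).

Lemma tens_indexP (x : 'I_tens_size.+1) : exists i j k, x = tens_index i j k.
Proof.
rewrite -[x](mxtens_unindexK (m := a.+1 * b.+1) (n := 2)).
case: (mxtens_unindex _) => y k; rewrite -[y](mxtens_unindexK (m := a.+1) (n := b.+1)).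
by case: (mxtens_unindex _) => i j; exists i, j, k.
Qed.

Lemma tens3E A B D i j k i' j' k' :
  tens3 A B D (tens_index i j k) (tens_index i' j' k') = A i i' * B j j' * D k k'.
Proof. by rewrite [LHS]tensmxE tensmxE. Qed.

Lemma tens3P (M N : cmat R tens_size) :
  (forall i j k i' j' k', M (tens_index i j k) (tens_index i' j' k')
    = N (tens_index i j k) (tens_index i' j' k')) -> M = N.
Proof.
move=> h; apply/matrixP => x y.
by have [i [j [k ->]]] := tens_indexP x; have [i' [j' [k' ->]]] := tens_indexP y.
Qed.

Lemma tens3M A B D A' B' D' :
  tens3 A B D * tens3 A' B' D' = tens3 (A * A') (B * B') (D * D').
Proof. by rewrite /tens3 -mulmxE -!tensmx_mul. Qed.

Lemma tens3_star A B D : star (tens3 A B D) = tens3 (star A) (star B) (star D).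
Proof.
apply: tens3P => i j k i' j' k'; rewrite [LHS]mxE !tens3E !mxE.
by rewrite !conjcM mulrC (mulrC (conjc _) (conjc (A _ _))).
Qed.

Lemma tens3_1 : tens3 1 1 1 = 1.
Proof.
apply: tens3P => i j k i' j' k'; rewrite tens3E !mxE -!natrM !mulnb; congr ((nat_of_bool _)%:R).
apply/idP/eqP => [/andP[/andP[/eqP-> /eqP->] /eqP->]//|E].
have {}E : (mxtens_index (i, j), k) = (mxtens_index (i', j'), k').
  exact: (can_inj (@mxtens_indexK (a.+1 * b.+1) 2)).
have -> : k = k' := congr1 snd E.
have [-> ->] : (i, j) = (i', j') := can_inj (@mxtens_indexK a.+1 b.+1) (congr1 fst E).
by rewrite !eqxx.
Qed.

Definition tens_l (A : cmat R a) := tens3 A 1 1.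
Definition tens_r (B : cmat R b) := tens3 1 B 1.

Lemma tens_l_linear : linear tens_l.
Proof.
by move=> c x y; apply: tens3P => *; rewrite [RHS]mxE [X in _ = X + _]mxE !tens3E !mxE !mulrDl !mulrA.
Qed.
HB.instance Definition _ := GRing.isLinear.Build C (cmat R a) (cmat R tens_size) _ tens_l
  tens_l_linear.
Lemma tens_l_monoid : monoid_morphism tens_l.
Proof. by split=> [|x y]; rewrite /tens_l ?tens3_1 // tens3M !mulr1. Qed.
HB.instance Definition _ := GRing.isMonoidMorphism.Build (cmat R a) (cmat R tens_size) tens_l
  tens_l_monoid.

Lemma tens_r_linear : linear tens_r.
Proof.
by move=> c x y; apply: tens3P => *; rewrite [RHS]mxE [X in _ = X + _]mxE !tens3E !mxE mulrDr !mulrDl mulrCA !mulrA.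
Qed.
HB.instance Definition _ := GRing.isLinear.Build C (cmat R b) (cmat R tens_size) _ tens_r
  tens_r_linear.
Lemma tens_r_monoid : monoid_morphism tens_r.
Proof. by split=> [|x y]; rewrite /tens_r ?tens3_1 // tens3M !mulr1. Qed.
HB.instance Definition _ := GRing.isMonoidMorphism.Build (cmat R b) (cmat R tens_size) tens_r
  tens_r_monoid.

Lemma tens_l_star : star_hom (tens_l : {lrmorphism _ -> _}).
Proof. by move=> A; rewrite /= /tens_l tens3_star !star1. Qed.

Lemma tens_r_star : star_hom (tens_r : {lrmorphism _ -> _}).
Proof. by move=> A; rewrite /= /tens_r tens3_star !star1. Qed.

Lemma tens3_neq0 A B D : A != 0 -> B != 0 -> D != 0 -> tens3 A B D != 0.
Proof.
have ex k (M : cmat R k) : M != 0 -> exists ij, M ij.1 ij.2 != 0.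
  move=> M0; apply: contrapT => /forallNP h; case/eqP: M0; apply/matrixP => i j.
  by rewrite mxE; apply/eqP/negPn/negP/(h (i, j)).
move=> /ex[[i i'] /= h1] /ex[[j j'] /= h2] /ex[[k k'] /= h3].
apply/eqP => /matrixP/(_ (tens_index i j k) (tens_index i' j' k')).
by rewrite tens3E mxE => /eqP; rewrite !mulf_eq0 (negPf h1) (negPf h2) (negPf h3).
Qed.

End TensorProduct.

(** * Two projections of M_2 at a prescribed angle *)

Section TwoProjections.
Variables (R : realType) (t : R).
Hypothesis t01 : 0 < t < 1.

Definition proj_e : cmat R 1 := \matrix_(i, j) ((i == 0) && (j == 0))%:R.
(** The projection onto the line through [(sqrt t, sqrt (1 - t))]: [t] is the squared cosine of its
    angle with the range of [proj_e]. *)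
Definition proj_f : cmat R 1 :=
  \matrix_(i, j) (if i == j then if i == 0 then t else 1 - t else Num.sqrt (t * (1 - t)))%:C.

Let t1 : 0 <= t * (1 - t).
Proof. by move: t01 => /andP[? ?]; rewrite mulr_ge0 //; lra. Qed.

Lemma conjc_realC (r : R) : conjc r%:C = r%:C.
Proof. by apply/eqP; rewrite eq_complex /= oppr0 !eqxx. Qed.

Lemma proj_eP : projection proj_e.
Proof.
split; apply/matrixP => i j; rewrite !mxE.
  by rewrite andbC; case: (_ && _); apply/eqP; rewrite eq_complex /= ?oppr0 !eqxx.
rewrite big_ord_recl big_ord1 !mxE /=.
by case: (i == 0); case: (j == 0); rewrite ?(mulr0, mul0r, mulr1, addr0).
Qed.

Lemma proj_fP : projection proj_f.
Proof.
have sq := sqr_sqrtr t1; rewrite expr2 in sq.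
split; apply/matrixP => i j; rewrite !mxE.
  by rewrite conjc_realC eq_sym; have [->|] := eqVneq i j.
rewrite big_ord_recl big_ord1 !mxE -!rmorphM -rmorphD; congr (_%:C).
have two (k : 'I_2) : k = 0 \/ k = 1.
  by case: k => [[|[|//]] h]; [left|right]; exact: val_inj.
by case: (two i) => ->; case: (two j) => -> /=; set s := Num.sqrt _ in sq *; rewrite ?sq; ring.
Qed.

Lemma proj_efe : proj_e * proj_f * proj_e = t%:C *: proj_e.
Proof.
apply/matrixP => i j; rewrite !mxE big_ord_recl big_ord1 !mxE !big_ord_recl !big_ord0 !mxE /=.
by case: (i == 0); case: (j == 0); rewrite ?(mulr0, mul0r, mulr1, mul1r, addr0).
Qed.

Lemma proj_ef_neq0 : proj_e * proj_f != 0.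
Proof.
apply/eqP => /matrixP/(_ 0 0); rewrite !mxE big_ord_recl big_ord1 !mxE /=.
rewrite mul1r mul0r addr0 => /eqP; rewrite eq_complex /= eqxx andbT => /eqP t0.
by move: t01; rewrite t0 ltxx.
Qed.

End TwoProjections.

Section Corner.
Variables (R : realType) (n : nat) (G : simple_graph n) (A : cstarAlgType R).

(* The quantum permutation [W] on the range of [e] and the identity on its kernel. *)
Definition corner (e : A) (W : 'M[A]_n) : 'M[A]_n :=
  \matrix_(x, y) (e * W x y + (x == y)%:R * (1 - e)).

(** Since [e] commutes with the entries of [W], the parts [e * W x y] and [1 - e] are orthogonal,
    and each condition splits into one on [W] and one on the identity matrix. *)
Lemma corner_quantum_permutation S e (W : 'M[A]_n) : projection e ->
  (forall x y, e * W x y = W x y * e) ->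
  quantum_permutation G S W -> quantum_permutation G S (corner e W).
Proof.
move=> pe eW [[pW rW cW] aW sW]; have [se ee] := pe; have [sr rr] := projectionC pe.
split; last first.
- move=> x y xy; rewrite mxE sW //; case: (x == y); first by rewrite mulr1 mul1r addrC subrK.
  by rewrite mulr0 mul0r addr0.
- have E : corner e W = e%:M *m W + (1 - e)%:M.
    apply/matrixP => x y; rewrite mxE mul_scalar_mx !mxE.
    by case: (x == y); rewrite ?mulr1n ?mulr0n ?mul1r ?mul0r.
  have scal c : adjacency A G *m c%:M = c%:M *m adjacency A G.
    apply/matrixP => x y; rewrite mul_scalar_mx !mxE (bigD1 y) //= big1 ?addr0 => [|k ky].
      by rewrite !mxE eqxx mulr1n; case: (G x y); rewrite ?mulr1 ?mul1r ?mulr0 ?mul0r.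
    by rewrite !mxE (negPf ky) mulr0n mulr0.
  by rewrite /adapted E mulmxDl mulmxDr scal mulmxA scal -!mulmxA aW.
split=> [x y|x|y].
- have [sw ww] := pW x y; rewrite mxE.
  have [sp pp] : projection (e * W x y).
    split; first by rewrite starM se sw eW.
    by rewrite -mulrA (mulrA (W x y)) -eW -mulrA ww mulrA ee.
  case: (x == y); last by rewrite mul0r addr0.
  have pr : (e * W x y) * (1 - e) = 0 by rewrite mulrBr mulr1 eW -mulrA ee subrr.
  have rp : (1 - e) * (e * W x y) = 0 by rewrite mulrBl mul1r mulrA ee subrr.
  rewrite mul1r; split; first by rewrite [LHS]starD sp sr.
  by rewrite [LHS]mulrDl (mulrDr (e * _)) (mulrDr (1 - e)) pp rr pr rp add0r addr0.
- under eq_bigr do rewrite mxE; rewrite big_split /= -mulr_sumr rW mulr1.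
  rewrite (bigD1 x) //= eqxx mul1r big1 ?addr0 => [|k kx]; first by rewrite addrC subrK.
  by rewrite eq_sym (negPf kx) mul0r.
- under eq_bigr do rewrite mxE; rewrite big_split /= -mulr_sumr cW mulr1.
  rewrite (bigD1 y) //= eqxx mul1r big1 ?addr0 => [|k ky]; first by rewrite addrC subrK.
  by rewrite (negPf ky) mul0r.
Qed.

Lemma cornerC e W x : 1 - corner e W x x = e * (1 - W x x).
Proof. by rewrite mxE eqxx mul1r mulrBr mulr1 opprD opprB addrCA [1 + _]addrC subrK addrC. Qed.

End Corner.

(** * Noncommutativity and infinite dimension *)

Section SpanningFamilies.
Variables (R : realType) (A B : cstarAlgType R).
Local Notation C := (R[i]).

Lemma map_lincomb (f : {lrmorphism A -> B}) d (b : 'I_d -> A) v :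
  f (lincomb b v) = lincomb (f \o b) v.
Proof. by rewrite /lincomb rmorph_sum /=; apply: eq_bigr => i _; rewrite linearZ. Qed.

Lemma map_span (f : {lrmorphism A -> B}) d (b : 'I_d -> A) x :
  in_span b x -> in_span (f \o b) (f x).
Proof. by move=> [v ->]; exists v; rewrite map_lincomb. Qed.

Lemma map_subalgebra (f : {lrmorphism A -> B}) d (b : 'I_d -> A) : star_hom f ->
  spans_subalgebra b -> spans_subalgebra (f \o b).
Proof.
move=> fs [b1 bM bS]; split; first by rewrite -(rmorph1 f); exact: map_span.
  move=> _ _ [v ->] [w ->]; rewrite -!map_lincomb -rmorphM; apply: map_span.
  by apply: bM; [exists v|exists w].
move=> _ [v ->]; rewrite -map_lincomb -fs; apply: map_span; apply: bS; by exists v.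
Qed.

(* Commuting projections span a finite-dimensional algebra: adjoining [p] to an
   algebra spanned by [b] gives the span of [b] and [p * b]. *)
Lemma commuting_projections_subalgebra (s : seq A) : commutative_alg A ->
  (forall p, p \in s -> projection p) ->
  exists d (b : 'I_d -> A), spans_subalgebra b /\ forall p, p \in s -> in_span b p.
Proof.
move=> comm; elim: s => [|p s IH] ps.
  exists 1, (fun=> 1); split=> //; have one x : in_span (fun _ : 'I_1 => 1 : A) x <-> exists c : C, x = c *: 1.
    split=> [[v ->]|[c ->]]; first by exists (v 0 0); rewrite /lincomb big_ord1.
    by exists (const_mx c); rewrite /lincomb big_ord1 mxE.
  split; first by apply/one; exists 1; rewrite scale1r.
    by move=> x y /one[c ->] /one[e ->]; apply/one; exists (c * e); rewrite -scalerAl mul1r scalerA.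
  by move=> x /one[c ->]; apply/one; exists (conjc c); rewrite starZ star1.
have [d [b [[b1 bM bS] bs]]] := IH (fun q qs => ps q (mem_behead (s := p :: s) qs)).
have [sp pp] := ps p (mem_head _ _).
pose b' (i : 'I_(d + d)) := match split i with inl j => b j | inr j => p * b j end.
have E v w : lincomb b' (row_mx v w) = lincomb b v + p * lincomb b w.
  rewrite /lincomb big_split_ord mulr_sumr /=; congr (_ + _); apply: eq_bigr => i _.
    by rewrite row_mxEl /b' (unsplitK (inl i)).
  by rewrite row_mxEr /b' (unsplitK (inr i)) scalerAr.
have spanE x : in_span b' x <-> exists y z, [/\ in_span b y, in_span b z & x = y + p * z].
  split=> [[u ->]|[_ [_ [[v ->] [w ->] ->]]]]; last by exists (row_mx v w); rewrite E.
  exists (lincomb b (lsubmx u)), (lincomb b (rsubmx u)).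
  by split; [exists (lsubmx u)|exists (rsubmx u)|rewrite -E hsubmxK].
have bD x y : in_span b x -> in_span b y -> in_span b (x + y).
  by move=> [v ->] [w ->]; exists (v + w); rewrite lincombD.
have b0 : in_span b 0 by exists 0; rewrite lincomb0.
exists (d + d)%N, b'; split; last first.
  move=> q; rewrite inE => /orP[/eqP->|qs]; apply/spanE.
    by exists 0, 1; split=> //; rewrite add0r mulr1.
  by exists q, 0; split=> //; [exact: bs|rewrite mulr0 addr0].
split; first by apply/spanE; exists 1, 0; split=> //; rewrite mulr0 addr0.
  move=> _ _ /spanE[y [z [hy hz ->]]] /spanE[y' [z' [hy' hz' ->]]]; apply/spanE.
  exists (y * y'), (y * z' + z * y' + z * z'); split; first exact: bM.
    by apply: (bD); [apply: (bD)|]; apply: bM.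
  rewrite !mulrDl !mulrDr !mulrA (comm y p) -!addrA; congr (_ + (_ + (_ + _))).
  by rewrite -[p * z * p * z']mulrA -[p * z * _]mulrA (mulrA z) (comm z p) !mulrA pp.
move=> _ /spanE[y [z [hy hz ->]]]; apply/spanE.
exists (star y), (star z); split; [exact: bS|exact: bS|].
by rewrite starD starM sp comm.
Qed.

(** The [d.+1] coordinate vectors of [1, ..., g ^+ d] in a [d]-dimensional space are dependent. The
    size bound limits the number of roots. *)
Lemma span_polynomial d (b : 'I_d -> A) (g : A) : (forall k, in_span b (g ^+ k)) ->
  exists2 p : {poly C}, p != 0 & (size p <= d.+1)%N /\ \sum_(k < d.+1) p`_k *: g ^+ k = 0.
Proof.
move=> bg; have [v vP] := choice bg.
pose M : 'M[C]_(d.+1, d) := \matrix_k v k.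
have kn0 : kermx M != 0.
  by rewrite -mxrank_eq0 mxrank_ker subn_eq0 -ltnNge ltnS rank_leq_col.
have /rowV0Pn[c /sub_kermxP cM c0] := kn0.
pose p : {poly C} := \poly_(k < d.+1) c 0 (inord k).
have pE (k : 'I_d.+1) : p`_k = c 0 k by rewrite coef_poly ltn_ord inord_val.
exists p.
  apply: contra c0 => /eqP p0; apply/eqP/rowP => k; by rewrite -pE p0 coef0 mxE.
split; first exact: size_poly.
have := congr1 (lincomb b) cM; rewrite lincomb0 mulmx_sum_row lincomb_sum => s0.
rewrite -[RHS]s0; apply: eq_bigr => k _; by rewrite lincombZ rowK pE {1}vP.
Qed.

End SpanningFamilies.

(** * Quantum permutations under maps that are multiplicative on a subspace only *)

Section PartialRepresentation.
Variables (R : realType) (n : nat) (G : simple_graph n) (A B : cstarAlgType R).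
Variables (d : nat) (b : 'I_d -> A) (rho : A -> B).
Hypothesis rhoD : forall x y, in_span b x -> in_span b y -> rho (x + y) = rho x + rho y.
Hypothesis rhoM : forall x y, in_span b x -> in_span b y -> rho (x * y) = rho x * rho y.
Hypothesis rhoS : forall x, in_span b x -> rho (star x) = star (rho x).
Hypothesis rho1 : rho 1 = 1.

Lemma partial_sum (J : finType) (F : J -> A) :
  (forall j, in_span b (F j)) -> rho (\sum_j F j) = \sum_j rho (F j).
Proof.
have b0 : in_span b 0 by exists 0; rewrite lincomb0.
have rho0 : rho 0 = 0 by apply: (addrI (rho 0)); rewrite -rhoD // !addr0.
move=> bF; pose K x y := in_span b x /\ rho x = y.
suff : K (\sum_j F j) (\sum_j rho (F j)) by case.
apply: (big_ind2 K) => [|x y z w [bx <-] [bz <-]|j _] //.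
split; last by rewrite rhoD.
by case: bx bz => [v ->] [v' ->]; exists (v + v'); rewrite lincombD.
Qed.

Lemma partial_quantum_permutation S (U : 'M[A]_n) : (forall x y, in_span b (U x y)) ->
  quantum_permutation G S U -> quantum_permutation G S (map_mx rho U).
Proof.
move=> bU [[pU rU cU] aU sU].
have b0 : in_span b 0 by exists 0; rewrite lincomb0.
have rho0 : rho 0 = 0 by apply: (addrI (rho 0)); rewrite -rhoD // !addr0.
split.
- split=> [x y|x|y].
  + by have [h1 h2] := pU x y; rewrite mxE; split; rewrite -?rhoS -?rhoM ?h1 ?h2.
  + by under eq_bigr do rewrite mxE; rewrite -partial_sum // rU.
  + by under eq_bigr do rewrite mxE; rewrite -partial_sum // cU.
- apply/matrixP => x y; rewrite !mxE.
  have nat_l (k : bool) z : in_span b z -> in_span b (k%:R * z) /\ rho (k%:R * z) = k%:R * rho z.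
    by case: k; rewrite ?mul1r ?mul0r.
  have nat_r (k : bool) z : in_span b z -> in_span b (z * k%:R) /\ rho (z * k%:R) = rho z * k%:R.
    by case: k; rewrite ?mulr1 ?mulr0.
  transitivity (rho ((U *m adjacency A G) x y)).
    rewrite mxE partial_sum => [|k]; last by rewrite mxE; apply: (nat_r _ _ _).1.
    by apply: eq_bigr => k _; rewrite !mxE (nat_r _ _ _).2.
  rewrite aU mxE partial_sum => [|k]; last by rewrite mxE; apply: (nat_l _ _ _).1.
  by apply: eq_bigr => k _; rewrite !mxE (nat_l _ _ _).2.
- move=> x y /sU; rewrite mxE => ->; by case: (x == y).
Qed.

End PartialRepresentation.

Section Main.
Variables (R : realType) (n : nat) (G : simple_graph n).
Local Notation C := (R[i]).

Lemma Supp_neq0 (A : cstarAlgType R) (U : 'M[A]_n) : magic_unitary U -> adapted G U ->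
  U <> 1%:M -> exists x, x \in Supp U.
Proof.
move=> mU aU U1; apply: contrapT => /forallNP no; apply: U1.
have [_ _ sU] := supported_on_Supp mU aU.
by apply/matrixP => x y; rewrite mxE sU // (introN idP (no x)).
Qed.

(* Two quantum permutations with disjoint supports, represented on commuting
   tensor factors and cut down by projections [e] and [f] with [e f e = t e]. *)
Lemma generic_position a b (S T : {set 'I_n}) (U : 'M[cmat R a]_n) (V : 'M[cmat R b]_n) x y (t : R) :
  [disjoint S & T] -> quantum_permutation G S U -> quantum_permutation G T V ->
  x \in S -> y \in T -> U x x != 1 -> V y y != 1 -> 0 < t < 1 ->
  exists (Z : cstarAlgType R) (W : 'M[Z]_n) (z : Z),
    [/\ magic_unitary W, adapted G W, (1 - W x x) * (1 - W y y) = z,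
        z * z = t%:C *: z & z != 0].
Proof.
move=> ST qU qV xS yT Ux Vy t01.
pose e : cmat R (tens_size a b) := tens3 1 1 (proj_e R).
pose f : cmat R (tens_size a b) := tens3 1 1 (proj_f t).
have proj3 (D : cmat R 1) : projection D -> projection (tens3 (1 : cmat R a) (1 : cmat R b) D).
  by move=> [sD DD]; split; rewrite ?tens3_star ?tens3M ?star1 ?mulr1 ?sD ?DD.
have pe : projection e by apply: proj3; exact: proj_eP.
have pf : projection f by apply: proj3; exact: proj_fP.
pose U' := corner e (map_mx (@tens_l R a b) U); pose V' := corner f (map_mx (@tens_r R a b) V).
have qU' : quantum_permutation G S U'.
  have ec i j : e * map_mx (@tens_l R a b) U i j = map_mx (@tens_l R a b) U i j * e.
    by rewrite mxE /e /tens_l !tens3M !mulr1 !mul1r.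
  exact: (corner_quantum_permutation pe ec (quantum_permutation_map (@tens_l_star R a b) qU)).
have qV' : quantum_permutation G T V'.
  have fc i j : f * map_mx (@tens_r R a b) V i j = map_mx (@tens_r R a b) V i j * f.
    by rewrite mxE /f /tens_r !tens3M !mulr1 !mul1r.
  exact: (corner_quantum_permutation pf fc (quantum_permutation_map (@tens_r_star R a b) qV)).
have [mW aW] := glue_magic ST qU' qV'.
pose p := 1 - U x x; pose q := 1 - V y y.
exists (cmat R (tens_size a b)), (glue S U' V'), (tens3 p q (proj_e R * proj_f t)).
have pp : p * p = p.
  by have [[/(_ x x) + _ _] _ _] := qU => /projectionC[].
have qq : q * q = q.
  by have [[/(_ y y) + _ _] _ _] := qV => /projectionC[].
split=> //.
- have -> : glue S U' V' x x = U' x x by rewrite mxE xS.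
  have -> : glue S U' V' y y = V' y y by rewrite mxE (disjointFl ST yT).
  rewrite !cornerC ![map_mx _ _ _ _]mxE.
  have -> : 1 - tens_l b (U x x) = tens_l b p by rewrite /p rmorphB rmorph1.
  have -> : 1 - tens_r a (V y y) = tens_r a q by rewrite /q rmorphB rmorph1.
  by rewrite /e /f /tens_l /tens_r !tens3M !mulr1 !mul1r.
(* The last tensor factor satisfies [(e f) (e f) = (e f e) f = t e f]. *)
- rewrite tens3M pp qq mulrA proj_efe // -scalerAl.
  by apply: tens3P => *; rewrite [RHS]mxE !tens3E [X in _ * X = _]mxE mulrCA.
- apply: tens3_neq0; last exact: proj_ef_neq0.
    by rewrite subr_eq0 eq_sym.
  by rewrite subr_eq0 eq_sym.
Qed.

Lemma no_finite_subalgebra (X Y : cstarAlgType R) (U : 'M[X]_n) (V : 'M[Y]_n)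
    (Q : cstarAlgType R) (q : 'M[Q]_n) d (b : 'I_d -> Q) :
  magic_unitary U -> magic_unitary V -> adapted G U -> adapted G V ->
  U <> 1%:M -> V <> 1%:M -> [disjoint Supp U & Supp V] -> is_CQu G q ->
  spans_subalgebra b -> (forall x y, in_span b (q x y)) -> False.
Proof.
move=> mU mV aU aV U1 V1 ST [mq aq gq uq] sub bq.
have [x xS] := Supp_neq0 mU aU U1; have [y yT] := Supp_neq0 mV aV V1.
have rep (Z : cstarAlgType R) (W : 'M[Z]_n) : magic_unitary W -> adapted G W ->
    exists k (W' : 'M[cmat R k]_n), quantum_permutation G (Supp W) W' /\
      forall z, z \in Supp W -> W' z z != 1.
  move=> mW aW; have [f fs fE] := uq _ _ mW aW.
  have [k [rho [rD rM rS r1 r0]]] := subalgebra_representation (map_subalgebra fs sub).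
  have bW i j : in_span (f \o b) (W i j) by rewrite -fE; apply: map_span.
  exists k, (map_mx rho W); split.
    exact: (partial_quantum_permutation rD rM rS r1 bW (supported_on_Supp mW aW)).
  (* The support survives in the matrices because [1 - W z z] lies in the span, on which [rho] is
     faithful. *)
  move=> z; rewrite inE mxE => Wz; apply: contra Wz => /eqP rz.
  have b1 : in_span (f \o b) 1 by have [] := map_subalgebra fs sub.
  have b1W : in_span (f \o b) (1 - W z z).
    case: b1 (bW z z) => [v ->] [w ->]; exists (v - w).
    by rewrite lincombB.
  rewrite eq_sym -subr_eq0; apply/eqP/r0 => //.
  by apply: (addIr (rho (W z z))); rewrite -rD // subrK r1 rz add0r.
have [k [U' [qU' U'1]]] := rep _ _ mU aU; have [l [V' [qV' V'1]]] := rep _ _ mV aV.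
pose g := (1 - q x x) * (1 - q y y).
have [b1 bM bS] := sub.
have bC i j : in_span b (1 - q i j).
  case: b1 (bq i j) => [v ->] [w ->]; exists (v - w).
  by rewrite lincombB.
have bg j : in_span b (g ^+ j).
  by elim: j => [|j IH]; rewrite ?expr0 // exprS; apply: (bM) => //; apply: (bM).
have [p p0 [sp ps]] := span_polynomial bg.
have root_p (t : R) : 0 < t < 1 -> root p t%:C.
  move=> t01; have [Z [W [z [mW aW zE zz z0]]]] :=
    generic_position ST qU' qV' xS yT (U'1 _ xS) (V'1 _ yT) t01.
  have [h _ hE] := uq _ _ mW aW.
  have hg : h g = z by rewrite rmorphM /= !rmorphB /= !rmorph1 !hE.
  have zX j : z ^+ j * z = t%:C ^+ j *: z.
    elim: j => [|j IH]; first by rewrite !expr0 mul1r scale1r.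
    by rewrite exprSr -mulrA zz -scalerAr IH scalerA exprS.
  (* Multiplying by [z] turns every term, the constant one included, into a multiple of [z]: the
     relation becomes [p(t) z = 0]. *)
  have := congr1 (fun w => h w * z) ps; rewrite /= rmorph_sum rmorph0 mul0r mulr_suml /=.
  under eq_bigr do rewrite linearZ /= rmorphXn /= hg -scalerAl zX scalerA.
  rewrite -scaler_suml => /eqP s0.
  apply/negPn/negP; rewrite rootE => n0; case/negP: z0.
  rewrite -(horner_coef_wide _ sp) in s0.
  by rewrite -(scale1r z) -(mulVf n0) -scalerA (eqP s0) scaler0.
(* The numbers [1 / (j + 2)] lie strictly between 0 and 1; [d.+1] of them are one more than the
   degree of [p] permits. *)
pose rs := [seq (j.+2%:R^-1 : R)%:C | j <- iota 0 d.+1].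
have rs_root : all (root p) rs.
  apply/allP => _ /mapP[j _ ->]; apply: root_p.
  by rewrite invr_gt0 ltr0n /= invf_lt1 ?ltr0n // ltr1n.
have rs_uniq : uniq rs.
  rewrite map_inj_uniq ?iota_uniq // => i j /complexI/invr_inj/eqP.
  by rewrite eqr_nat => /eqP[].
have := max_poly_roots p0 rs_root rs_uniq.
by rewrite size_map size_iota ltnNge sp.
Qed.

Lemma disjoint_supports_infinite (X Y : cstarAlgType R) (U : 'M[X]_n) (V : 'M[Y]_n)
    (Q : cstarAlgType R) (q : 'M[Q]_n) :
  magic_unitary U -> magic_unitary V -> adapted G U -> adapted G V ->
  U <> 1%:M -> V <> 1%:M -> [disjoint Supp U & Supp V] -> is_CQu G q ->
  ~ commutative_alg Q /\ infinite_dimensional Q.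
Proof.
move=> mU mV aU aV U1 V1 ST CQ.
have contra d (b : 'I_d -> Q) := no_finite_subalgebra mU mV aU aV U1 V1 ST CQ (b := b).
split.
  move=> comm; have [mq _ _ _] := CQ; have [pq _ _] := mq.
  have ps p : p \in [seq q xy.1 xy.2 | xy : 'I_n * 'I_n] -> projection p.
    by move=> /mapP[xy _ ->].
  have [d [b [sub bq]]] := commuting_projections_subalgebra comm ps.
  apply: (contra d b sub) => x y; apply: bq.
  by apply/mapP; exists (x, y); rewrite ?mem_enum.
move=> d b; apply: contrapT => /forallNP no.
have all a : in_span b a.
  have /existsNP[c /contrapT ->] := no a.
  by exists (\row_i c i); apply: eq_bigr => i _; rewrite mxE.
by apply: (contra d b) => //; split.
Qed.

End Main.

Theorem theorem2p12 (R : realType) (n : nat) (n_gt0 : (0 < n)%N)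
    (G : simple_graph n)
    (X Y : cstarAlgType R) (U : 'M[X]_n) (V : 'M[Y]_n)
    (magicU : magic_unitary U) (magicV : magic_unitary V)
    (adaptedU : adapted G U) (adaptedV : adapted G V)
    (U_neq1 : U <> 1%:M) (V_neq1 : V <> 1%:M)
    (disjointUV : Supp U :&: Supp V = set0) :
  [/\ exists (X' Y' : cstarAlgType R) (F : cstarAlgType R)
             (iX : {lrmorphism X' -> F}) (iY : {lrmorphism Y' -> F}),
        [/\ nontrivial X', nontrivial Y', is_free_product iX iY &
         forall (Q : cstarAlgType R) (q : 'M[Q]_n),
           is_CQu G q -> is_quotient Q F],
      forall (Q : cstarAlgType R) (q : 'M[Q]_n),
        is_CQu G q -> ~ commutative_alg Q /\ infinite_dimensional Q &
      has_quantum_symmetry R G].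
Proof.
have ST : [disjoint Supp U & Supp V] by rewrite -setI_eq0 disjointUV.
have inf (Q : cstarAlgType R) (q : 'M[Q]_n) (CQ : is_CQu G q) :=
  disjoint_supports_infinite magicU magicV adaptedU adaptedV U_neq1 V_neq1 ST CQ.
split=> //.
- have [iX [iY free]] := qperm_pair_free_product R G (Supp U) (Supp V).
  exists (qperm R G (Supp U)), (qperm R G (Supp V)), (qperm_pair R G (Supp U) (Supp V)), iX, iY.
  split=> //; try exact: qperm_nontrivial (supported_on_Supp _ _) _.
  by move=> Q q CQ; exact: qperm_pair_quotient ST CQ.
- exists (qperm R G [set: 'I_n]), (qperm_gen R G [set: 'I_n]).
  by split; [exact: qperm_setT_is_CQu|case: (inf _ _ (qperm_setT_is_CQu R G))].
Qed.
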